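(* The following hold: 1. If $T\in\mathcal{B}'_{aa}$, then $T^{(i)}\in\mathcal{B}'_{aa}$ for all $i\in\mathbb{Z}_+$. 2. If $T\in\mathcal{B}'_{aa}\cap\mathcal{B}'_{+,0}$, then $T=0$. 3. If $T\in\mathcal{B}'_{aa}$, then $\tau_hT\in\mathcal{B}'_{aa}$ for all $h\in\mathbb{R}$. 4. $\mathcal{B}'_{aa}\ast\mathcal{D}'_{L^1}\subset\mathcal{B}'_{aa}$, i.e. $T\ast S\in\mathcal{B}'_{aa}$ for all $T\in\mathcal{B}'_{aa}$ and $S\in\mathcal{D}'_{L^1}$. 5. $\mathcal{B}_{aa}\times\mathcal{B}'_{aa}\subset\mathcal{B}'_{aa}$, i.e. $\varphi T\in\mathcal{B}'_{aa}$ for all $\varphi\in\mathcal{B}_{aa}$ and $T\in\mathcal{B}'_{aa}$.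
   Context: All functions and distributions are complex-valued and defined on $\mathbb{R}$; $\mathcal{D}$ is the space of smooth compactly supported functions and $\mathcal{D}'$ the space of distributions. Derivatives of distributions are distributional. A continuous function $f:\mathbb{R}\to\mathbb{C}$ is almost automorphic if for every real sequence $(s_m)_{m\in\mathbb{N}}$ there is a subsequence $(s_{m_k})_k$ such that $g(x):=\lim_{k\to+\infty}f(x+s_{m_k})$ is well-defined for every $x\in\mathbb{R}$ and $\lim_{k\to+\infty}g(x-s_{m_k})=f(x)$ for every $x\in\mathbb{R}$. $\mathcal{C}_{aa}$ denotes the space of almost automorphic functions, and $\mathcal{B}_{aa}=\{\varphi\in\mathcal{C}^\infty:\ \varphi^{(i)}\in\mathcal{C}_{aa}\ \forall i\in\mathbb{Z}_+\}$. For $p\in[1,+\infty]$, $\mathcal{D}_{L^p}=\{\varphi\in\mathcal{C}^\infty:\ \varphi^{(i)}\in L^p\ \forall i\in\mathbb{Z}_+\}$ with the norms $|\varphi|_{m,p}=\sum_{i=0}^m\|\varphi^{(i)}\|_{L^p}$, $m\in\mathbb{Z}_+$. $\mathcal{D}'_{L^\infty}$ is the topological dual of $\mathcal{D}_{L^1}$; its elements are called bounded distributions. $\dot{\mathcal{B}}$ is the closure of $\mathcal{D}$ in $\mathcal{D}_{L^\infty}$, and $\mathcal{D}'_{L^1}$ is the topological dual of $\dot{\mathcal{B}}$. Both duals are regarded as subspaces of $\mathcal{D}'$. A distribution belongs to $\mathcal{D}'_{L^p}$ ($p=1,\infty$) if and only if it is a finite sum $\sum_{j=0}^kf_j^{(j)}$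 with $f_j\in L^p$. For $T=\sum_{l=0}^kf_l^{(l)}\in\mathcal{D}'_{L^\infty}$ ($f_l\in L^\infty$) and $S=\sum_{j=0}^mg_j^{(j)}\in\mathcal{D}'_{L^1}$ ($g_j\in L^1$), the convolution is $T\ast S=\sum_{l=0}^k\sum_{j=0}^m(f_l\ast g_j)^{(l+j)}\in\mathcal{D}'_{L^\infty}$ (independent of the representations). For $\varphi\in\mathcal{D}$, $(T\ast\varphi)(x)=\langle T,\varphi(x-\cdot)\rangle$. A distribution $T\in\mathcal{D}'_{L^\infty}$ is called almost automorphic if it satisfies either of the following equivalent conditions: (i) $T\ast\varphi\in\mathcal{C}_{aa}$ for all $\varphi\in\mathcal{D}$; (ii) $T=\sum_{j=0}^kf_j^{(j)}$ for some $k\in\mathbb{Z}_+$ and $f_0,\dots,f_k\in\mathcal{C}_{aa}$ (distributional derivatives). $\mathcal{B}'_{aa}$ is the space of almost automorphic distributions. For $h\in\mathbb{R}$ and $T\in\mathcal{D}'$, $\tau_hT$ is defined by $\langle\tau_hT,\varphi\rangle=\langle T,\tau_{-h}\varphi\rangle$, $\varphi\in\mathcal{D}$, where $\tau_{-h}\varphi(x)=\varphi(x-h)$. $\mathcal{B}'_{+,0}$ is the space of $T\in\mathcal{D}'$ such that $\lim_{h\to+\infty}\tau_hT=0$ in $\mathcal{D}'$. *)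

(* Defs.v *)
From HB Require Import structures.
From mathcomp Require Import all_boot all_order all_algebra.
From mathcomp Require Import all_classical all_reals all_analysis.
From mathcomp Require Import complex.
Set Implicit Arguments.
Unset Strict Implicit.
Unset Printing Implicit Defensive.
Import Order.TTheory GRing.Theory Num.Theory numFieldNormedType.Exports.
Local Open Scope classical_set_scope.
Local Open Scope ring_scope.

(* R[i] seen as a numFieldType, the structure that carries its topology. *)
Definition Cplx (R : realType) : numFieldType := R[i]%C.

Definition rpart (R : realType) (f : R -> Cplx R) : R -> R :=
  fun x => complex.Re (f x).
Definition ipart (R : realType) (f : R -> Cplx R) : R -> R :=
  fun x => complex.Im (f x).

Definition modulus (R : realType) (z : Cplx R) : R := Normc.normc z.

(* R[i] is not a normed module over R in the library, so derivatives and
   integrals of complex-valued functions of a real variable are taken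
   componentwise. *)
Definition cderiv (R : realType) (n : nat) (f : R -> Cplx R) : R -> Cplx R :=
  fun x => (derive1n n (rpart f) x +i* derive1n n (ipart f) x)%C.

Definition smooth (R : realType) (f : R -> Cplx R) : Prop :=
  forall (n : nat) (x : R),
    derivable (derive1n n (rpart f)) x 1 /\ derivable (derive1n n (ipart f)) x 1.

Definition cintegral (R : realType) (f : R -> Cplx R) : Cplx R :=
  ((\int[lebesgue_measure]_x rpart f x)
    +i* (\int[lebesgue_measure]_x ipart f x))%C.

Definition Lpnorm (R : realType) (p : \bar R) (f : R -> Cplx R) : \bar R :=
  ('N[lebesgue_measure]_p[(fun x => (modulus (f x))%:E)])%E.

Definition Lp (R : realType) (p : \bar R) : set (R -> Cplx R) :=
  [set f | [/\ measurable_fun setT (rpart f), measurable_fun setT (ipart f)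
             & (Lpnorm p f < +oo)%E]].

Definition almost_automorphic (R : realType) (f : R -> Cplx R) : Prop :=
  continuous f /\
  forall s : nat -> R,
    exists k : nat -> nat, {homo k : m n / (m < n)%N} /\
    exists g : R -> Cplx R,
      (forall x : R, f (x + s (k n)) @[n --> \oo] --> g x) /\
      (forall x : R, g (x - s (k n)) @[n --> \oo] --> f x).

(* The space B_aa of smooth almost automorphic functions. *)
Definition smooth_aa (R : realType) : set (R -> Cplx R) :=
  [set f | smooth f /\ forall i : nat, almost_automorphic (cderiv i f)].

(* The norm |f|_{m,p}. *)
Definition snorm (R : realType) (m : nat) (p : \bar R) (f : R -> Cplx R) :
    \bar R :=
  (\sum_(i < m.+1) Lpnorm p (cderiv i f))%E.

Definition DLp (R : realType) (p : \bar R) : set (R -> Cplx R) :=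
  [set f | smooth f /\ forall i : nat, Lp p (cderiv i f)].

Definition test_on (R : realType) (a : R) : set (R -> Cplx R) :=
  [set f | smooth f /\ forall x : R, a < `|x| -> f x = 0].

Definition test (R : realType) : set (R -> Cplx R) :=
  [set f | exists a : R, test_on a f].

(* The closure of D in D_{L^oo}; the norms snorm m increase with m, so the
   balls of a single norm form a basis of neighbourhoods. *)
Definition Bdot (R : realType) : set (R -> Cplx R) :=
  [set f | DLp +oo%E f /\
     forall (m : nat) (e : R), 0 < e ->
       exists psi : R -> Cplx R, test psi /\
         (snorm m +oo (fun x => (f x - psi x)%R) < e%:E)%E].

(* Functionals are total on functions; only their values on the space under
   consideration (the test functions, for distributions) are meaningful, and
   equality of distributions is [eq_on_test]. *)
Definition functional (R : realType) : Type := (R -> Cplx R) -> Cplx R.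

Definition eq_on_test (R : realType) (T U : functional R) : Prop :=
  forall phi : R -> Cplx R, test phi -> T phi = U phi.

Definition linear_on (R : realType) (E : set (R -> Cplx R))
    (U : functional R) : Prop :=
  forall (a : Cplx R) (phi psi : R -> Cplx R), E phi -> E psi ->
    U (fun x => a * phi x + psi x) = a * U phi + U psi.

(* Continuity on E for the topology of the norms (snorm m p), m in nat. *)
Definition continuous_on (R : realType) (E : set (R -> Cplx R)) (p : \bar R)
    (U : functional R) : Prop :=
  forall phi0 : R -> Cplx R, E phi0 -> forall e : R, 0 < e ->
    exists (m : nat) (d : R), 0 < d /\
      forall phi : R -> Cplx R, E phi ->
        (snorm m p (fun x => (phi x - phi0 x)%R) < d%:E)%E ->
        modulus (U phi - U phi0) < e.

Definition dual (R : realType) (E : set (R -> Cplx R)) (p : \bar R) :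
    set (functional R) :=
  [set U | linear_on E U /\ continuous_on E p U].

(* D is the strict inductive limit of the Frechet spaces [test_on a], so a
   linear form on D is continuous iff its restriction to each of them is. *)
Definition distribution (R : realType) : set (functional R) :=
  [set T | linear_on (@test R) T /\
     forall a : R, continuous_on (test_on a) +oo%E T].

Definition bounded_distribution (R : realType) : set (functional R) :=
  [set T | distribution T /\
     exists2 U : functional R, dual (DLp 1%E) 1%E U & eq_on_test T U].

Definition integrable_distribution (R : realType) : set (functional R) :=
  [set T | distribution T /\
     exists2 U : functional R, dual (@Bdot R) +oo%E U & eq_on_test T U].

Definition regular (R : realType) (f : R -> Cplx R) : functional R :=
  fun phi => cintegral (fun x => f x * phi x).

Definition dderiv (R : realType) (n : nat) (T : functional R) : functional R :=
  fun phi => (-1) ^+ n * T (cderiv n phi).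

Definition dtranslate (R : realType) (h : R) (T : functional R) :
    functional R :=
  fun phi => T (fun x => phi (x - h)).

Definition dmul (R : realType) (f : R -> Cplx R) (T : functional R) :
    functional R :=
  fun phi => T (fun x => f x * phi x).

(* The distribution f_0 + f_1' + ... + f_k^(k). *)
Definition sum_dderiv (R : realType) (k : nat) (f : nat -> R -> Cplx R) :
    functional R :=
  fun phi => \sum_(j < k.+1) dderiv j (regular (f j)) phi.

Definition fconv (R : realType) (f g : R -> Cplx R) : R -> Cplx R :=
  fun x => cintegral (fun y => f (x - y) * g y).

(* U = T * S, computed from some representations of T in D'_{L^oo} and of
   S in D'_{L^1} as finite sums of derivatives. *)
Definition is_conv (R : realType) (T S U : functional R) : Prop :=
  exists (k m : nat) (f g : nat -> R -> Cplx R),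
    [/\ (forall l : nat, (l <= k)%N -> Lp +oo%E (f l)),
        (forall j : nat, (j <= m)%N -> Lp 1%E (g j)),
        eq_on_test T (sum_dderiv k f),
        eq_on_test S (sum_dderiv m g)
      & eq_on_test U (fun phi => \sum_(l < k.+1) \sum_(j < m.+1)
          dderiv (l + j) (regular (fconv (f l) (g j))) phi)].

(* The space B'_aa. *)
Definition aa_distribution (R : realType) : set (functional R) :=
  [set T | bounded_distribution T /\
     exists (k : nat) (f : nat -> R -> Cplx R),
       (forall j : nat, (j <= k)%N -> almost_automorphic (f j)) /\
       eq_on_test T (sum_dderiv k f)].

(* The space B'_{+,0}; the limit is taken pointwise on test functions. *)
Definition vanishing_distribution (R : realType) : set (functional R) :=
  [set T | distribution T /\
     forall phi : R -> Cplx R, test phi ->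
       dtranslate h T phi @[h --> +oo%R] --> (0 : Cplx R)].

(* Main.v *)
(* If T = sum_j f_j^(j) with f_j almost automorphic, then U phi =
   sum_j (-1)^j int f_j phi^(j) is continuous on D_{L^1}, because almost
   automorphic functions are bounded; so a distribution of this form is
   automatically bounded, and each item reduces to exhibiting such a form
   ([aa_form]).
   - Derivatives, translates and multiples by phi in B_aa are handled on the
     f_j, the last by induction on the order using the Leibniz rule.
   - If T also lies in B'_{+,0}, then h |-> <T, phi(. - h)> is a finite sum of
     convolutions of the f_j with functions in L^1; it is therefore almost
     automorphic, tends to 0 at +oo, and hence vanishes identically.
   - By Fubini, <T * g^(j), phi> = (-1)^j int g(y) <T, phi^(j)(. + y)> dy
     depends on T only, so the L^oo representation of T used to compute T * S
     can be exchanged for the almost automorphic one; and the convolution of an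
     almost automorphic function with an L^1 function is almost automorphic, by
     dominated convergence. *)
Require Import Defs.
From HB Require Import structures.
From mathcomp Require Import all_boot all_order all_algebra.
From mathcomp Require Import all_classical all_reals all_analysis.
From mathcomp Require Import complex measurable_realfun ess_sup_inf.
From mathcomp Require Import ring lra.
Set Implicit Arguments.
Unset Strict Implicit.
Unset Printing Implicit Defensive.
Import Order.TTheory GRing.Theory Num.Theory numFieldNormedType.Exports.
Local Open Scope classical_set_scope.
Local Open Scope ring_scope.

(** * Complex arithmetic, modulus and limits through real and imaginary parts *)

Section Cplx_theory.
Variable R : realType.
Implicit Types (z w : Cplx R) (f g : R -> Cplx R).

Lemma cReD z w : complex.Re (z + w) = complex.Re z + complex.Re w.
Proof. by case: z w => [a b] [c d]. Qed.

Lemma cImD z w : complex.Im (z + w) = complex.Im z + complex.Im w.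
Proof. by case: z w => [a b] [c d]. Qed.

Lemma cReN z : complex.Re (- z) = - complex.Re z.
Proof. by case: z. Qed.

Lemma cImN z : complex.Im (- z) = - complex.Im z.
Proof. by case: z. Qed.

Lemma cReM z w : complex.Re (z * w) =
  complex.Re z * complex.Re w - complex.Im z * complex.Im w.
Proof. by case: z w => [a b] [c d]. Qed.

Lemma cImM z w : complex.Im (z * w) =
  complex.Re z * complex.Im w + complex.Im z * complex.Re w.
Proof. by case: z w => [a b] [c d]. Qed.

Lemma Cplx_eq z w : complex.Re z = complex.Re w ->
  complex.Im z = complex.Im w -> z = w.
Proof. by case: z w => [a b] [c d] /= -> ->. Qed.

Lemma norm_modulus z : `|z| = ((modulus z)%:C)%C :> R[i].
Proof. by case: z. Qed.

Lemma modulus_ge0 z : 0 <= modulus z.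
Proof. by case: z => a b; exact: sqrtr_ge0. Qed.

Lemma modulusM z w : modulus (z * w) = modulus z * modulus w.
Proof. exact: Normc.normcM. Qed.

Lemma modulusD z w : modulus (z + w) <= modulus z + modulus w.
Proof. exact: le_normcD. Qed.

Lemma modulusN z : modulus (- z) = modulus z.
Proof. exact: normcN. Qed.

Lemma modulus0 : modulus (0 : Cplx R) = 0.
Proof. exact: Normc.normc0. Qed.

Lemma modulusXN1 n : modulus ((-1) ^+ n : Cplx R) = 1.
Proof.
elim: n => [|n ih]; first exact: Normc.normc1.
by rewrite exprS modulusM ih mulr1 modulusN; exact: Normc.normc1.
Qed.

Lemma le_Re_modulus z : `|complex.Re z| <= modulus z.
Proof.
case: z => a b; rewrite /modulus /= -sqrtr_sqr ler_wsqrtr//= lerDl; exact: sqr_ge0.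
Qed.

Lemma le_Im_modulus z : `|complex.Im z| <= modulus z.
Proof.
case: z => a b; rewrite /modulus /= -sqrtr_sqr ler_wsqrtr//= lerDr; exact: sqr_ge0.
Qed.

Lemma modulus_le z : modulus z <= `|complex.Re z| + `|complex.Im z|.
Proof.
case: z => a b; rewrite /modulus /=.
have ab0 : 0 <= `|a| + `|b| by rewrite addr_ge0.
rewrite -[leRHS](ger0_norm ab0) -(sqrtr_sqr (_ + _)) ler_wsqrtr//.
rewrite sqrrD !real_normK ?num_real// [leRHS]addrAC lerDl.
by rewrite mulrn_wge0// mulr_ge0.
Qed.

(** The modulus dominates each component and is at most the sum of their absolute values, so limits
    can be checked on components. Real-valued theorems are transferred to [Cplx R] in this way. *)
Lemma cvg_Cplx (I : Type) (F : set_system I) (FF : Filter F)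
    (h : I -> Cplx R) z :
  (h @ F --> z) <-> (complex.Re (h i) @[i --> F] --> complex.Re z) /\
                    (complex.Im (h i) @[i --> F] --> complex.Im z).
Proof.
split=> [/cvgrPdist_lt hz|[/cvgrPdist_lt hr /cvgrPdist_lt hi]].
  split; apply/cvgrPdist_lt => e e0.
    have e0' : 0 < (e%:C)%C :> Cplx R by rewrite ltcR.
    apply: filterS (hz _ e0') => i; rewrite norm_modulus ltcR => /=.
    by apply: le_lt_trans; rewrite -cReN -cReD; exact: le_Re_modulus.
  have e0' : 0 < (e%:C)%C :> Cplx R by rewrite ltcR.
  apply: filterS (hz _ e0') => i; rewrite norm_modulus ltcR => /=.
  by apply: le_lt_trans; rewrite -cImN -cImD; exact: le_Im_modulus.
apply/cvgrPdist_lt => e e0.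
(* The radius [e] lives in the complex field; being positive it is a real number [r], and each
   component receives half of it. *)
have /complex_realP[r re] : e \is Num.real by exact: gtr0_real.
have r0 : 0 < r by move: e0; rewrite re ltcR.
have r20 : 0 < r / 2 by rewrite divr_gt0.
apply: filterS2 (hr _ r20) (hi _ r20) => i /= h1 h2.
rewrite norm_modulus re ltcR (le_lt_trans (modulus_le _))//.
by rewrite cReD cImD cReN cImN [ltRHS]splitr ltrD.
Qed.

End Cplx_theory.

(** * Measurability of complex-valued functions *)

Definition cmeasurable (R : realType) d (T : measurableType d)
    (f : T -> Cplx R) : Prop :=
  measurable_fun setT (fun x => complex.Re (f x)) /\
  measurable_fun setT (fun x => complex.Im (f x)).

Section cmeasurable_theory.
Variables (R : realType) (d : measure_display) (T : measurableType d).
Implicit Types f g : T -> Cplx R.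

Lemma cmeasurableD f g : cmeasurable f -> cmeasurable g ->
  cmeasurable (fun x => f x + g x).
Proof.
move=> [fr fi] [gr gi]; split.
  by under eq_fun do rewrite cReD; exact: measurable_funD.
by under eq_fun do rewrite cImD; exact: measurable_funD.
Qed.

Lemma cmeasurableM f g : cmeasurable f -> cmeasurable g ->
  cmeasurable (fun x => f x * g x).
Proof.
move=> [fr fi] [gr gi]; split.
  under eq_fun do rewrite cReM.
  by apply: measurable_funB; exact: measurable_funM.
under eq_fun do rewrite cImM.
by apply: measurable_funD; exact: measurable_funM.
Qed.

Lemma measurable_modulus f : cmeasurable f ->
  measurable_fun setT (fun x => modulus (f x)).
Proof.
move=> [fr fi].
have -> : (fun x => modulus (f x)) =
    Num.sqrt \o (fun x => complex.Re (f x) ^+ 2 + complex.Im (f x) ^+ 2).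
  by apply/funext => x /=; case: (f x).
apply: (measurableT_comp (continuous_measurable_fun (@sqrt_continuous R))).
by apply: measurable_funD; exact: measurable_funX.
Qed.

Lemma cmeasurable_comp d' (T' : measurableType d') (f : T' -> Cplx R)
    (h : T -> T') : cmeasurable f -> measurable_fun setT h ->
  cmeasurable (fun x => f (h x)).
Proof.
by move=> [fr fi] mh; split;
  [exact: measurableT_comp fr mh|exact: measurableT_comp fi mh].
Qed.

Lemma cmeasurable_cvg (f_ : nat -> T -> Cplx R) f :
  (forall n, cmeasurable (f_ n)) -> (forall x, f_ n x @[n --> \oo] --> f x) ->
  cmeasurable f.
Proof.
move=> mf fcv; split.
  apply: (@measurable_fun_cvg _ _ _ _ (fun n x => complex.Re (f_ n x))).
    by move=> n; have [] := mf n.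
  by move=> x _; have /cvg_Cplx[] := fcv x.
apply: (@measurable_fun_cvg _ _ _ _ (fun n x => complex.Im (f_ n x))).
  by move=> n; have [] := mf n.
by move=> x _; have /cvg_Cplx[] := fcv x.
Qed.

End cmeasurable_theory.

Lemma continuous_cmeasurable (R : realType) (f : R -> Cplx R) :
  continuous f -> cmeasurable f.
Proof.
move=> cf; split; apply: continuous_measurable_fun => x.
  by have /cvg_Cplx[] := cf x.
by have /cvg_Cplx[] := cf x.
Qed.

(** * Integration of complex-valued functions: linearity, bounds, dominated convergence *)

Definition cintegrable (R : realType) (f : R -> Cplx R) : Prop :=
  (@lebesgue_measure R).-integrable setT (EFin \o rpart f) /\
  (@lebesgue_measure R).-integrable setT (EFin \o ipart f).

Section cintegral_theory.
Variable R : realType.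
Local Notation mu := (@lebesgue_measure R).
Implicit Types (f g : R -> Cplx R) (c : Cplx R).

Lemma cintegrable_le f (g : R -> R) : cmeasurable f ->
  mu.-integrable setT (EFin \o g) -> (forall x, modulus (f x) <= g x) ->
  cintegrable f.
Proof.
move=> [fr fi] ig fg; split; apply: le_integrable ig => //.
- exact/measurable_EFinP.
- move=> x _; rewrite lee_fin (le_trans (le_Re_modulus _))//.
  by rewrite (le_trans (fg x))// ler_norm.
- exact/measurable_EFinP.
- move=> x _; rewrite lee_fin (le_trans (le_Im_modulus _))//.
  by rewrite (le_trans (fg x))// ler_norm.
Qed.

Lemma cintegrable_cmeasurable f : cintegrable f -> cmeasurable f.
Proof.
by move=> [/measurable_int/measurable_EFinP fr /measurable_int/measurable_EFinP fi].
Qed.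

Lemma cintegrable_modulus f : cintegrable f ->
  mu.-integrable setT (EFin \o (fun x => modulus (f x))).
Proof.
move=> fi.
have mf := cintegrable_cmeasurable fi.
have [/integrable_abse ir /integrable_abse ii] := fi.
apply: le_integrable (integrableD measurableT ir ii) => //.
  exact/measurable_EFinP/measurable_modulus.
move=> x _ /=; rewrite lee_fin (ger0_norm (modulus_ge0 _)).
by rewrite (le_trans (modulus_le _))// ler_norm.
Qed.

Lemma Lp1_cintegrable f : Lp 1%E f <-> cintegrable f.
Proof.
split=> [[fr fi]|fi].
  rewrite /Lpnorm Lnorm1 => fl.
  have mf : cmeasurable f by [].
  apply: (@cintegrable_le f (fun x => modulus (f x))) => //.
  by apply/integrableP; split=> //; exact/measurable_EFinP/measurable_modulus.
have [mr mi] := cintegrable_cmeasurable fi.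
split=> //; rewrite /Lpnorm Lnorm1.
by have /integrableP[] := cintegrable_modulus fi.
Qed.

Lemma cintegrableM f (h : R -> Cplx R) (C : R) : cintegrable f ->
  cmeasurable h -> (forall x, modulus (h x) <= C) ->
  cintegrable (fun x => h x * f x).
Proof.
move=> fi mh hC.
apply: (@cintegrable_le _ (fun x => C * modulus (f x))).
- by apply: cmeasurableM => //; exact: cintegrable_cmeasurable.
- exact: (integrableZl measurableT C (cintegrable_modulus fi)).
- by move=> x; rewrite modulusM ler_wpM2r// modulus_ge0.
Qed.

Lemma cintegrableZ f c : cintegrable f -> cintegrable (fun x => c * f x).
Proof.
by move=> fi; apply: (@cintegrableM _ _ (modulus c)).
Qed.

Lemma cintegrableD f g : cintegrable f -> cintegrable g ->
  cintegrable (fun x => f x + g x).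
Proof.
move=> fi gi; apply: (@cintegrable_le _ (fun x => modulus (f x) + modulus (g x))).
- by apply: cmeasurableD; exact: cintegrable_cmeasurable.
- exact: (integrableD measurableT (cintegrable_modulus fi) (cintegrable_modulus gi)).
- by move=> x; exact: modulusD.
Qed.

Lemma cintegrable0 : cintegrable (fun=> 0 : Cplx R).
Proof. by split; exact: (integrable0 mu setT). Qed.

Lemma cintegralD f g : cintegrable f -> cintegrable g ->
  cintegral (fun x => f x + g x) = cintegral f + cintegral g.
Proof.
move=> [fr fi] [gr gi]; rewrite /cintegral; apply: Cplx_eq => /=.
  rewrite -RintegralD//; apply: eq_Rintegral => x _; exact: cReD.
rewrite -RintegralD//; apply: eq_Rintegral => x _; exact: cImD.
Qed.

Lemma cintegralZ f c : cintegrable f ->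
  cintegral (fun x => c * f x) = c * cintegral f.
Proof.
move=> [fr fi]; rewrite /cintegral; apply: Cplx_eq.
  rewrite cReM /= -!RintegralZl// -RintegralB//; last 2 first.
  - exact: (integrableZl measurableT _ fr).
  - exact: (integrableZl measurableT _ fi).
  by apply: eq_Rintegral => x _; exact: cReM.
rewrite cImM /= -!RintegralZl// -RintegralD//; last 2 first.
- exact: (integrableZl measurableT _ fi).
- exact: (integrableZl measurableT _ fr).
by apply: eq_Rintegral => x _; exact: cImM.
Qed.

Lemma cintegrable_sum (I : Type) (r : seq I) (F : I -> R -> Cplx R) :
  (forall i, cintegrable (F i)) -> cintegrable (fun x => \sum_(i <- r) F i x).
Proof.
move=> Fi; elim: r => [|i r ih].
  by under eq_fun do rewrite big_nil; exact: cintegrable0.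
by under eq_fun do rewrite big_cons; exact: cintegrableD.
Qed.

Lemma cintegral0 : cintegral (fun=> 0 : Cplx R) = 0.
Proof.
rewrite -[RHS](mul0r (cintegral (fun=> 0))) -(cintegralZ _ cintegrable0).
by congr cintegral; apply/funext => x; rewrite mul0r.
Qed.

Lemma cintegral_sum (I : Type) (r : seq I) (F : I -> R -> Cplx R) :
  (forall i, cintegrable (F i)) ->
  cintegral (fun x => \sum_(i <- r) F i x) = \sum_(i <- r) cintegral (F i).
Proof.
move=> Fi; elim: r => [|i r ih].
  rewrite big_nil -[RHS]cintegral0; congr cintegral.
  by apply/funext => x; rewrite big_nil.
rewrite big_cons -ih -cintegralD//; last exact: cintegrable_sum.
by congr cintegral; apply/funext => x; rewrite big_cons.
Qed.

(** The factor 2 comes from bounding the real and the imaginary part separately, each by the L^1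
    norm; it is harmless in continuity estimates. *)
Lemma le_modulus_cintegral f : cintegrable f ->
  ((modulus (cintegral f))%:E <= 2%:E * Lpnorm 1 f)%E.
Proof.
move=> fi; rewrite /Lpnorm Lnorm1.
under eq_integral do rewrite /= ger0_norm ?modulus_ge0//.
have im := cintegrable_modulus fi.
rewrite -(fineK (integrable_fin_num _ im))//= -EFinM lee_fin.
apply: (le_trans (modulus_le (cintegral f))); rewrite [leRHS]mulr_natl mulr2n.
have [/[dup] fr /integrable_abse ir /[dup] fI /integrable_abse ii] := fi.
apply: lerD; (apply: (le_trans (le_normr_Rintegral _ _)) => //;
  apply: le_Rintegral => //).
  by move=> x _; exact: le_Re_modulus.
by move=> x _; exact: le_Im_modulus.
Qed.

Lemma Rintegral_dominated (f_ : nat -> R -> R) (f g : R -> R) :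
  (forall n, measurable_fun setT (f_ n)) ->
  (forall x, f_ n x @[n --> \oo] --> f x) ->
  mu.-integrable setT (EFin \o g) ->
  (forall n x, `|f_ n x| <= g x) ->
  \int[mu]_x f_ n x @[n --> \oo] --> \int[mu]_x f x.
Proof.
move=> mf fcv ig fg.
have mlim : measurable_fun setT f.
  by apply: (@measurable_fun_cvg _ _ _ _ f_) => // x _; exact: fcv.
have [fi _ fl] : [/\ mu.-integrable setT (EFin \o f),
    \int[mu]_x `|(f_ n x)%:E - (f x)%:E|%E @[n --> \oo] --> 0%E
    & \int[mu]_x (f_ n x)%:E @[n --> \oo] --> \int[mu]_x (f x)%:E]%E.
  apply: (@dominated_convergence _ _ _ mu setT measurableT
    (fun n => EFin \o f_ n) (EFin \o f) (EFin \o g)) => //.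
  - by move=> n; apply/measurable_EFinP; exact: mf.
  - exact/measurable_EFinP.
  - by apply: aeW => x _; apply: cvg_EFin; [exact: nearW|exact: fcv].
  - by apply: aeW => x n _; rewrite lee_fin.
by apply: fine_cvg; rewrite fineK// integrable_fin_num.
Qed.

Lemma cintegral_dominated (f_ : nat -> R -> Cplx R) f (g : R -> R) :
  (forall n, cmeasurable (f_ n)) ->
  (forall x, f_ n x @[n --> \oo] --> f x) ->
  mu.-integrable setT (EFin \o g) ->
  (forall n x, modulus (f_ n x) <= g x) ->
  cintegral (f_ n) @[n --> \oo] --> cintegral f.
Proof.
move=> mf fcv ig fg.
apply/cvg_Cplx; split; apply: (@Rintegral_dominated _ _ g) => //.
- by move=> n; have [] := mf n.
- by move=> x; have /cvg_Cplx[] := fcv x.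
- by move=> n x; rewrite (le_trans _ (fg n x))//; exact: le_Re_modulus.
- by move=> n; have [] := mf n.
- by move=> x; have /cvg_Cplx[] := fcv x.
- by move=> n x; rewrite (le_trans _ (fg n x))//; exact: le_Im_modulus.
Qed.

End cintegral_theory.

(** * Change of variables under translations and reflections *)

Definition measure_preserving (R : realType) (p : R -> R) : Prop :=
  measurable_fun setT p /\
  forall A : set R, measurable A ->
    (@lebesgue_measure R) (p @^-1` A) = (@lebesgue_measure R) A.

Section change_of_variables.
Variable R : realType.
Local Notation mu := (@lebesgue_measure R).

(** Lebesgue measure is determined by its values on half-open intervals, so the pushforward by [p]
    has to be compared with it only there. *)
Lemma measure_preserving_itv (p : R -> R) : measurable_fun setT p ->
  (forall a b : R, mu (p @^-1` `]a, b]%classic) = mu `]a, b]%classic) ->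
  measure_preserving p.
Proof.
move=> mp pab; split=> // A mA.
pose mp' : {mfun measurableTypeR R >-> measurableTypeR R} :=
  HB.pack p (isMeasurableFun.Build _ _ (measurableTypeR R) (measurableTypeR R) p mp).
apply/esym; apply: (@lebesgue_measure_unique _ (pushforward mu mp')) => //.
by move=> _ [[a b] _ <-]; rewrite /= /pushforward; exact/esym/pab.
Qed.

Lemma measure_preserving_addr (h : R) : measure_preserving (fun x => x + h).
Proof.
apply: measure_preserving_itv => [|a b].
  exact: measurable_funD.
have -> : (fun x => x + h) @^-1` `]a, b]%classic = `]a - h, b - h]%classic.
  by apply/seteqP; split=> x /=; rewrite !in_itv/= ltrBlDr lerBrDr.
by rewrite !lebesgue_measure_itv/= !lte_fin ltrD2r; case: ifPn => // _;
  rewrite -!EFinB opprB addrA subrK.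
Qed.

Lemma measure_preserving_subl (h : R) : measure_preserving (fun x => h - x).
Proof.
apply: measure_preserving_itv => [|a b].
  exact: measurable_funB.
(* The reflection reverses the interval, so its closed end moves from right to left; the length is
   unchanged. *)
have -> : (fun x => h - x) @^-1` `]a, b]%classic = `[h - b, h - a[%classic.
  by apply/seteqP; split=> x /=; rewrite !in_itv/=; lra.
rewrite !lebesgue_measure_itv/= !lte_fin ltrD2l ltrN2; case: ifPn => // _.
by rewrite -!EFinB; congr EFin; ring.
Qed.

Variable p : R -> R.
Hypothesis pP : measure_preserving p.

Lemma measure_preserving_cmeasurable (f : R -> Cplx R) : cmeasurable f ->
  cmeasurable (f \o p).
Proof. by move=> mf; apply: cmeasurable_comp => //; have [] := pP. Qed.

(** For nonnegative functions this is the pushforward formula, the pushforward agreeing with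
    Lebesgue measure; the general case splits into positive and negative parts. *)
Lemma measure_preserving_integral (f : R -> \bar R) : measurable_fun setT f ->
  (\int[mu]_x f (p x) = \int[mu]_x f x)%E.
Proof.
move=> mf; have [mp pA] := pP.
pose mp' : {mfun measurableTypeR R >-> measurableTypeR R} :=
  HB.pack p (isMeasurableFun.Build _ _ (measurableTypeR R) (measurableTypeR R) p mp).
have ge0 (g : R -> \bar R) : measurable_fun setT g -> (forall x, 0 <= g x)%E ->
    (\int[mu]_x g (p x) = \int[mu]_x g x)%E.
  move=> mg g0.
  have := @ge0_integral_pushforward _ _ (measurableTypeR R) (measurableTypeR R) _
    p mp mu setT g measurableT mg
    (fun x _ => g0 x).
  rewrite preimage_setT => <-.
  by apply: (@eq_measure_integral _ _ _ _ mu (pushforward mu mp')) => A mA _;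
    exact: pA.
rewrite integralE [RHS]integralE; congr (_ - _)%E.
  rewrite -(ge0 _ (measurable_funepos mf) (funepos_ge0 f)).
  by apply: eq_integral => x _; rewrite !funeposE.
rewrite -(ge0 _ (measurable_funeneg mf) (funeneg_ge0 f)).
by apply: eq_integral => x _; rewrite !funenegE.
Qed.

Lemma measure_preserving_cintegral (f : R -> Cplx R) : cmeasurable f ->
  cintegral (fun x => f (p x)) = cintegral f.
Proof.
move=> [fr fi]; rewrite /cintegral; congr (_ +i* _)%C; congr fine.
  by apply: (@measure_preserving_integral (EFin \o rpart f)); exact/measurable_EFinP.
by apply: (@measure_preserving_integral (EFin \o ipart f)); exact/measurable_EFinP.
Qed.

Lemma measure_preserving_cintegrable (f : R -> Cplx R) : cintegrable f ->
  cintegrable (fun x => f (p x)).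
Proof.
move=> fi; have mf := cintegrable_cmeasurable fi.
apply/Lp1_cintegrable; have [mr mi] := measure_preserving_cmeasurable mf.
split=> //; rewrite /Lpnorm Lnorm1.
have mm := measurable_modulus mf.
rewrite (@measure_preserving_integral (fun x => `|(modulus (f x))%:E|%E)).
  by have [_ _] := (Lp1_cintegrable f).2 fi; rewrite /Lpnorm Lnorm1.
by apply: measurableT_comp => //; exact/measurable_EFinP.
Qed.

End change_of_variables.

(** * Fubini's theorem for kernels dominated by a product *)

Section integrable_prod.
Variable R : realType.
Local Notation mu := (@lebesgue_measure R).

Variables (K : R * R -> R) (a b : R -> R).
Hypotheses (mK : measurable_fun setT K) (ia : mu.-integrable setT (EFin \o a))
  (ib : mu.-integrable setT (EFin \o b))
  (Kab : forall x y, `|K (x, y)| <= a x * b y).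

Let iKx x : mu.-integrable setT (EFin \o (fun y => K (x, y))).
Proof.
apply: le_integrable (integrableZl measurableT (a x) ib) => //.
  by apply/measurable_EFinP; apply: measurableT_comp.
by move=> y _; rewrite /= lee_fin (le_trans (Kab x y))// ler_norm.
Qed.

(** By Tonelli: the integral of [|K (x, y)|] over [y] is at most [|a x|] times the integral of
    [|b|], so the iterated integral of [|K|] is finite. *)
Lemma integrable_prod_dominated : (mu \x mu)%E.-integrable setT (EFin \o K).
Proof.
have mK' : measurable_fun [set: measurableTypeR R * measurableTypeR R] (EFin \o K).
  exact/measurable_EFinP.
apply/integrable12ltyP => //.
have mF : measurable_fun setT (fun x => \int[mu]_y `|(K (x, y))%:E|)%E.
  apply: (@measurable_fun_fubini_tonelli_F _ _ _ _ R mu (fun z => `|(K z)%:E|%E)) => //.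
  exact: measurableT_comp.
set B := fine (\int[mu]_y `|(b y)%:E|)%E.
have B0 : 0 <= B by apply/fine_ge0/integral_ge0.
have iaB : mu.-integrable setT (EFin \o (fun x => B * a x)).
  exact: (integrableZl measurableT B ia).
suff /integrableP[_] : mu.-integrable setT
    (fun x => \int[mu]_y `|(K (x, y))%:E|)%E.
  apply: le_lt_trans; apply: ge0_le_integral => //.
  - by move=> x _; exact: integral_ge0.
  - exact: measurableT_comp.
  - by move=> x _; exact: lee_abs.
apply: le_integrable iaB => // x _.
rewrite gee0_abs; last exact: integral_ge0.
have ibn := integrable_abse ib.
rewrite /= normrM mulrC (ger0_norm B0).
rewrite EFinM fineK; last exact: integrable_fin_num ibn.
rewrite -ge0_integralZl//; last exact: measurable_int ibn.
apply: ge0_le_integral => //.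
- exact: measurable_int (integrable_abse (iKx x)).
- by apply: measurable_funeM; exact: measurable_int ibn.
- by move=> y _; rewrite -EFinM lee_fin -normrM (le_trans (Kab x y))// ler_norm.
Qed.

End integrable_prod.

Section cfubini.
Variable R : realType.
Local Notation mu := (@lebesgue_measure R).

Lemma Rintegral_fubini (K : R * R -> R) (a b : R -> R) :
  measurable_fun setT K ->
  mu.-integrable setT (EFin \o a) -> mu.-integrable setT (EFin \o b) ->
  (forall x y, `|K (x, y)| <= a x * b y) ->
  mu.-integrable setT (EFin \o (fun y => \int[mu]_x K (x, y))) /\
  \int[mu]_x \int[mu]_y K (x, y) = \int[mu]_y \int[mu]_x K (x, y).
Proof.
move=> mK ia ib Kab.
have iKx x : mu.-integrable setT (EFin \o (fun y => K (x, y))).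
  apply: le_integrable (integrableZl measurableT (a x) ib) => //.
    by apply/measurable_EFinP; apply: measurableT_comp.
  by move=> y _; rewrite /= lee_fin (le_trans (Kab x y))// ler_norm.
have iKy y : mu.-integrable setT (EFin \o (fun x => K (x, y))).
  apply: le_integrable (integrableZl measurableT (b y) ia) => //.
    by apply/measurable_EFinP; apply: measurableT_comp.
  by move=> x _; rewrite /= lee_fin mulrC (le_trans (Kab x y))// ler_norm.
split.
  (* The integral over [x], as a function of [y], is the inner integral of the kernel with swapped
     coordinates. *)
  have iKs : (mu \x mu)%E.-integrable setT (EFin \o (K \o (fun z => (z.2, z.1)))).
    apply: (integrable_prod_dominated _ ib ia).
      by apply: measurableT_comp => //; exact: measurable_swap.
    by move=> y x; rewrite mulrC; exact: Kab.
  rewrite (_ : _ \o _ = fubini_F mu (EFin \o (K \o (fun z => (z.2, z.1))))).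
    exact: integrable_fubini_F.
  apply/funext => y; rewrite /fubini_F /= fineK//; exact: integrable_fin_num (iKy y).
have := Fubini (integrable_prod_dominated mK ia ib Kab).
rewrite /Rintegral => h; congr fine.
(* The inner integrals are finite, so [fine] loses nothing and the extended-real Fubini theorem
   applies. *)
transitivity (\int[mu]_x \int[mu]_y (K (x, y))%:E)%E.
  by apply: eq_integral => x _; rewrite fineK//; exact: integrable_fin_num (iKx x).
rewrite h; apply: eq_integral => y _; rewrite fineK//.
exact: integrable_fin_num (iKy y).
Qed.

Lemma cintegral_fubini (K : R * R -> Cplx R) (a b : R -> R) :
  cmeasurable K ->
  mu.-integrable setT (EFin \o a) -> mu.-integrable setT (EFin \o b) ->
  (forall x y, modulus (K (x, y)) <= a x * b y) ->
  cintegrable (fun y => cintegral (fun x => K (x, y))) /\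
  cintegral (fun x => cintegral (fun y => K (x, y))) =
  cintegral (fun y => cintegral (fun x => K (x, y))).
Proof.
move=> [mr mi] ia ib Kab.
have [x y|ir er] := Rintegral_fubini mr ia ib.
  by rewrite (le_trans _ (Kab x y))//; exact: le_Re_modulus.
have [x y|ii ei] := Rintegral_fubini mi ia ib.
  by rewrite (le_trans _ (Kab x y))//; exact: le_Im_modulus.
by split=> //; rewrite /cintegral; congr (_ +i* _)%C.
Qed.

End cfubini.

(** * Almost automorphic functions: boundedness, algebra, convolution, behaviour at infinity *)

Lemma modulus_cvg_le (R : realType) (u : nat -> Cplx R) (z : Cplx R) (C : R) :
  u n @[n --> \oo] --> z -> (forall n, modulus (u n) <= C) -> modulus z <= C.
Proof.
move=> /cvgrPdist_lt uz uC; rewrite leNgt; apply/negP => Cz.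
have e0 : 0 < ((modulus z - C)%:C)%C :> Cplx R by rewrite ltcR subr_gt0.
have [N _ /(_ N (leqnn N))] := uz _ e0.
rewrite /= norm_modulus ltcR => h.
have := modulusD (z - u N) (u N); rewrite subrK => /le_lt_trans.
by move=> /(_ _ (ltr_leD h (uC N))); rewrite subrK ltxx.
Qed.

Lemma extraction_cvg (k : nat -> nat) : {homo k : m n / (m < n)%N} ->
  k n @[n --> \oo] --> \oo.
Proof.
move=> hk; have kn n : (n <= k n)%N.
  by elim: n => // n ih; exact: leq_ltn_trans ih (hk _ _ _).
by apply/cvgnyPge => A; exists A => // n /= An; exact: leq_trans (kn n).
Qed.

Section almost_automorphic_theory.
Variable R : realType.
Local Notation mu := (@lebesgue_measure R).
Implicit Types (f g h : R -> Cplx R).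

Lemma aa_continuous f : almost_automorphic f -> continuous f.
Proof. by case. Qed.

Lemma aa_cmeasurable f : almost_automorphic f -> cmeasurable f.
Proof. by move=> /aa_continuous; exact: continuous_cmeasurable. Qed.

Lemma aa_cst (c : Cplx R) : almost_automorphic (fun=> c).
Proof.
split; first by move=> x; exact: cvg_cst.
move=> s; exists id; split=> //; exists (fun=> c).
by split=> x; exact: cvg_cst.
Qed.

(** If [f] were unbounded, points [s n] with [modulus (f (s n)) > n] would exist, and no subsequence
    of [f (0 + s n)] could converge. *)
Lemma aa_bounded f : almost_automorphic f ->
  exists C : R, forall x, modulus (f x) <= C.
Proof.
move=> [_ faa]; apply: contrapT => nC.
have /choice[s sP] n : exists x, n%:R < modulus (f x).
  apply: contrapT => ns; apply: nC; exists n%:R => x.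
  by rewrite leNgt; apply/negP => h; apply: ns; exists x.
have [k [hk [g [fg _]]]] := faa s.
have /cvgrPdist_lt/(_ 1 ltr01)[N _ NP] := fg 0.
have kn n : (n <= k n)%N.
  by elim: n => // n ih; exact: leq_ltn_trans ih (hk _ _ _).
have [M MP] : exists M : nat, modulus (g 0) + 1 <= M%:R.
  exists (Num.truncn (modulus (g 0) + 1)).+1.
  exact/ltW/truncnS_gt.
(* At this index the value of [f] is within 1 of [g 0], hence below [M] in modulus, while the choice
   of [s] makes it larger than [M]. *)
have := NP (maxn N M) (leq_maxl _ _).
rewrite /= add0r norm_modulus (_ : 1 = (1%:C)%C)// ltcR -modulusN opprB.
set z := f _ => h.
have : modulus z < M%:R.
  apply: lt_le_trans MP; rewrite -(subrK (g 0) z).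
  by rewrite (le_lt_trans (modulusD _ _))// addrC ltrD2l.
apply/negP; rewrite -leNgt (le_trans _ (ltW (sP _)))// ler_nat.
exact: leq_trans (leq_maxr N M) (kn _).
Qed.

(** A subsequence is extracted for [f], then a further one for [g]; the limits for [f] survive the
    second extraction. Continuity of [op] is phrased with arbitrary filters so that it serves both
    for continuity at a point and for sequences. *)
Lemma aa_op (op : Cplx R -> Cplx R -> Cplx R) :
  (forall (I : Type) (F : set_system I), Filter F ->
     forall (u v : I -> Cplx R) a b, u i @[i --> F] --> a ->
       v i @[i --> F] --> b -> op (u i) (v i) @[i --> F] --> op a b) ->
  forall f g, almost_automorphic f -> almost_automorphic g ->
    almost_automorphic (fun x => op (f x) (g x)).
Proof.
move=> op_cvg f g [cf faa] [cg gaa]; split.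
  by move=> x; apply: op_cvg; [exact: cf|exact: cg].
move=> s.
have [k [hk [f' [ff' f'f]]]] := faa s.
have [l [hl [g' [gg' g'g]]]] := gaa (s \o k).
have ly := extraction_cvg hl.
exists (k \o l); split; first by move=> m n mn; exact/hk/hl.
exists (fun x => op (f' x) (g' x)); split=> x; apply: op_cvg.
- exact: (cvg_comp l (fun n => f (x + s (k n))) ly (ff' x)).
- exact: gg'.
- exact: (cvg_comp l (fun n => f' (x - s (k n))) ly (f'f x)).
- exact: g'g.
Qed.

Lemma aaD f g : almost_automorphic f -> almost_automorphic g ->
  almost_automorphic (fun x => f x + g x).
Proof.
move=> faa gaa; apply: (@aa_op (fun z w => z + w) _ f g faa gaa).
by move=> I F FF u v a b ua vb; exact: (cvgD ua vb).
Qed.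

Lemma aaM f g : almost_automorphic f -> almost_automorphic g ->
  almost_automorphic (fun x => f x * g x).
Proof.
move=> faa gaa; apply: (@aa_op (fun z w => z * w) _ f g faa gaa).
by move=> I F FF u v a b ua vb; exact: (cvgM ua vb).
Qed.

Lemma aaZ (c : Cplx R) f : almost_automorphic f ->
  almost_automorphic (fun x => c * f x).
Proof. by move=> faa; exact: (aaM (aa_cst c) faa). Qed.

Lemma aa_sum (I : Type) (r : seq I) (P : pred I) (F : I -> R -> Cplx R) :
  (forall i, P i -> almost_automorphic (F i)) ->
  almost_automorphic (fun x => \sum_(i <- r | P i) F i x).
Proof.
move=> Faa; elim: r => [|i r ih].
  have -> : (fun x => \sum_(i <- [::] | P i) F i x) = fun=> 0.
    by apply/funext => x; rewrite big_nil.
  exact: aa_cst.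
have [Pi|/negbTE nPi] := boolP (P i).
  have -> : (fun x => \sum_(j <- i :: r | P j) F j x) =
      fun x => F i x + \sum_(j <- r | P j) F j x.
    by apply/funext => x; rewrite big_cons Pi.
  exact: (aaD (Faa i Pi) ih).
have -> : (fun x => \sum_(j <- i :: r | P j) F j x) =
    fun x => \sum_(j <- r | P j) F j x.
  by apply/funext => x; rewrite big_cons nPi.
exact: ih.
Qed.

Lemma aa_shift (h : R) f : almost_automorphic f ->
  almost_automorphic (fun x => f (x + h)).
Proof.
move=> [cf faa]; split=> [x|s].
  apply: (@continuous_comp _ _ _ (fun x => x + h) f); last exact: cf.
  by apply: cvgD; [exact: cvg_id|exact: cvg_cst].
have [k [hk [f' [ff' f'f]]]] := faa s.
exists k; split=> //; exists (fun x => f' (x + h)); split=> x.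
  by under eq_fun do rewrite addrAC; exact: ff'.
by under eq_fun do rewrite addrAC; exact: f'f.
Qed.

(** Dominated convergence with the majorant [C * modulus (h y)]. *)
Lemma fconv_cvg (u : nat -> R -> Cplx R) f h (C : R) x :
  (forall n, cmeasurable (u n)) -> (forall n y, modulus (u n y) <= C) ->
  (forall y, u n y @[n --> \oo] --> f y) -> cintegrable h ->
  fconv (u n) h x @[n --> \oo] --> fconv f h x.
Proof.
move=> mu_ uC uf ih.
apply: (@cintegral_dominated _ _ _ (fun y => C * modulus (h y))).
- move=> n; apply: cmeasurableM; last exact: cintegrable_cmeasurable.
  apply: measure_preserving_cmeasurable => //; exact: measure_preserving_subl.
- by move=> y; apply: cvgM; [exact: uf|exact: cvg_cst].
- exact: (integrableZl measurableT C (cintegrable_modulus ih)).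
- by move=> n y; rewrite modulusM ler_wpM2r// modulus_ge0.
Qed.

(** Translations pass onto the first factor, so limits along translates of [fconv f h] become limits
    of convolutions with a varying first factor. *)
Lemma fconv_shift f h (x t : R) :
  fconv f h (x + t) = fconv (fun y => f (y + t)) h x.
Proof.
by rewrite /fconv; congr cintegral; apply/funext => y; rewrite addrAC.
Qed.

Lemma cmeasurable_shift (t : R) f : cmeasurable f ->
  cmeasurable (fun x : R => f (x + t)).
Proof. by apply: measure_preserving_cmeasurable; exact: measure_preserving_addr. Qed.

(** Along a sequence [u n] tending to [x], the displacement [u n - x] is moved onto [f], whose
    translates converge pointwise by continuity and stay bounded by [C]. *)
Lemma continuous_fconv f h : continuous f ->
  (exists C, forall x, modulus (f x) <= C) -> cintegrable h ->
  continuous (fconv f h).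
Proof.
move=> cf [C fC] ih x.
have seq_cvg (u : nat -> R) : u n @[n --> \oo] --> x ->
    fconv f h (u n) @[n --> \oo] --> fconv f h x.
  move=> ux; under eq_fun do rewrite -(subrK x (u _)) addrC fconv_shift.
  apply: (@fconv_cvg _ _ _ C) => //.
    by move=> n; exact/cmeasurable_shift/continuous_cmeasurable.
  move=> y; apply: (@cvg_comp _ _ _ (fun n => y + (u n - x)) f); last exact: cf.
  have : y + (u n - x) @[n --> \oo] --> y + (x - x).
    by apply: cvgD; [exact: cvg_cst|apply: cvgB => //; exact: cvg_cst].
  by rewrite subrr addr0.
(* On the real line sequences suffice; the sequential criterion is applied to each real
   component. *)
apply/cvg_Cplx; split.
  apply/(@cvg_nbhsP _ R^o (rpart (fconv f h))) => u ux.
  by have /cvg_Cplx[] := seq_cvg _ ux.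
apply/(@cvg_nbhsP _ R^o (ipart (fconv f h))) => u ux.
by have /cvg_Cplx[] := seq_cvg _ ux.
Qed.

(** The subsequence chosen for [f] also works for the convolution, with limit function [fconv g h];
    dominated convergence gives both limits. *)
Lemma aa_fconv f h : almost_automorphic f -> cintegrable h ->
  almost_automorphic (fconv f h).
Proof.
move=> faa ih; have mf := aa_cmeasurable faa; have [C fC] := aa_bounded faa.
split; first by apply: continuous_fconv => //; [exact: aa_continuous|exists C].
move=> s; have [k [hk [g [fg gf]]]] := faa.2 s.
exists k; split=> //; exists (fconv g h).
(* The limit [g] may be discontinuous; as a pointwise limit of translates of [f] it is still
   measurable and inherits the bound [C]. *)
have mg : cmeasurable g.
  apply: (cmeasurable_cvg _ fg) => n; exact: cmeasurable_shift.
have gC y : modulus (g y) <= C by apply: (modulus_cvg_le (fg y)).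
split=> x; under eq_fun do rewrite fconv_shift; apply: (@fconv_cvg _ _ _ C) => //.
  by move=> n; exact: cmeasurable_shift.
by move=> n; exact: cmeasurable_shift.
Qed.

(** Along the sequence of natural numbers, the translates of [f] tend to 0, so the limit function
    [g] vanishes; translating back recovers [f] as a limit of zeros. *)
Lemma aa_cvg_pinfty0 f : almost_automorphic f ->
  f x @[x --> +oo] --> (0 : Cplx R) -> forall x, f x = 0.
Proof.
move=> [_ faa] f0; have [k [hk [g [fg gf]]]] := faa (fun n => n%:R).
have g0 x : g x = 0.
  apply: (@cvg_unique _ (@norm_hausdorff _ _) _ _ _ _ (fg x)).
  apply: (cvg_comp (fun n => x + (k n)%:R) f _ f0).
  have ky : ((k n)%:R : R) @[n --> \oo] --> +oo.
    by apply/cvgrnyP; exact: extraction_cvg.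
  apply/cvgryPge => A; move/cvgryPge/(_ (A - x)) : ky.
  by apply: filterS => n; rewrite lerBlDl.
move=> x; have := gf x; rewrite (_ : g = fun=> 0); last exact/funext.
by move=> h; apply: (cvg_unique (@norm_hausdorff _ _) h); exact: cvg_cst.
Qed.

End almost_automorphic_theory.

(** * Derivatives and smoothness of complex-valued functions *)

Section complex_derivative.
Variable R : realType.
Implicit Types (f g : R -> Cplx R) (x : R) (z w : Cplx R).

(** A relational form of the derivative: it carries differentiability and the value together, so
    that the real sum and product rules apply component by component. *)
Definition cis_derive f x z : Prop :=
  is_derive x 1 (rpart f) (complex.Re z) /\
  is_derive x 1 (ipart f) (complex.Im z).

Lemma cis_derive_derivable f x z : cis_derive f x z ->
  derivable (rpart f) x 1 /\ derivable (ipart f) x 1.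
Proof. by move=> [[fr _] [fi _]]; split; [exact: fr|exact: fi]. Qed.

Lemma cderiv1_val f x z : cis_derive f x z -> cderiv 1 f x = z.
Proof.
move=> [[_ fr] [_ fi]]; apply: Cplx_eq; rewrite /= derive1E.
  exact: fr.
exact: fi.
Qed.

Lemma derivable_cis_derive f x : derivable (rpart f) x 1 ->
  derivable (ipart f) x 1 -> cis_derive f x (cderiv 1 f x).
Proof.
move=> fr fi; split; apply: DeriveDef.
- exact: fr.
- by rewrite /= derive1E.
- exact: fi.
- by rewrite /= derive1E.
Qed.

Lemma cis_deriveD f g x z w : cis_derive f x z -> cis_derive g x w ->
  cis_derive (fun y => f y + g y) x (z + w).
Proof.
move=> [fr fi] [gr gi]; split.
  rewrite cReD (_ : rpart _ = rpart f + rpart g); first exact: is_deriveD.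
  by apply/funext => y; exact: cReD.
rewrite cImD (_ : ipart _ = ipart f + ipart g); first exact: is_deriveD.
by apply/funext => y; exact: cImD.
Qed.

Lemma cis_deriveM f g x z w : cis_derive f x z -> cis_derive g x w ->
  cis_derive (fun y => f y * g y) x (z * g x + f x * w).
Proof.
move=> [fr fi] [gr gi]; split.
  rewrite (_ : rpart _ = rpart f * rpart g - ipart f * ipart g); last first.
    by apply/funext => y; exact: cReM.
  apply: (is_derive_eq (is_deriveB (is_deriveM fr gr) (is_deriveM fi gi))).
  by rewrite cReD !cReM /rpart /ipart /GRing.scale/=; ring.
rewrite (_ : ipart _ = rpart f * ipart g + ipart f * rpart g); last first.
  by apply/funext => y; exact: cImM.
apply: (is_derive_eq (is_deriveD (is_deriveM fr gi) (is_deriveM fi gr))).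
by rewrite cImD !cImM /rpart /ipart /GRing.scale/=; ring.
Qed.

Lemma cis_derive_cst z x : cis_derive (fun=> z) x 0.
Proof. by split; exact: is_derive_cst. Qed.

Lemma cderiv_comp m n f : cderiv m (cderiv n f) = cderiv (m + n) f.
Proof.
by apply/funext => x; apply: Cplx_eq => /=;
  rewrite /derive1n iterD; congr (iter m _ _ x).
Qed.

Lemma cderiv0 f : cderiv 0 f = f.
Proof. by apply/funext => x; apply: Cplx_eq. Qed.

Lemma smooth_derivable f n x : smooth f ->
  cis_derive (cderiv n f) x (cderiv 1 (cderiv n f) x).
Proof.
move=> sf; apply: derivable_cis_derive.
  by have [fr _] := sf n x; exact: fr.
by have [_ fi] := sf n x; exact: fi.
Qed.

(* Order-by-order form of [smooth], peeling derivatives off from the inside so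
   that sums and products can be treated by induction on the order. *)
Fixpoint nsmooth (n : nat) f : Prop :=
  if n is m.+1 then
    (forall x, cis_derive f x (cderiv 1 f x)) /\ nsmooth m (cderiv 1 f)
  else True.

Lemma nsmoothW n f : nsmooth n.+1 f -> nsmooth n f.
Proof.
elim: n f => [//|n ih] f [df sf].
by split; [exact: df|exact: (ih _ sf)].
Qed.

(** [smooth] adds derivatives from the outside and [nsmooth] from the inside; the inductions
    therefore range over all [f], and [cderiv_comp] exchanges the two orders. *)
Lemma smoothP f : smooth f <-> forall n, nsmooth n f.
Proof.
split=> [sf n|sf n x].
  have {sf} : forall m x, cis_derive (cderiv m f) x (cderiv 1 (cderiv m f) x).
    by move=> m x; exact: smooth_derivable.
  elim: n f => [//|n ih] f sf; split.
    by move=> x; have := sf 0%N x; rewrite cderiv0.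
  by apply: ih => m x; have := sf m.+1 x; rewrite !cderiv_comp addn1.
suff : cis_derive (cderiv n f) x (cderiv 1 (cderiv n f) x).
  exact: cis_derive_derivable.
have := sf n.+1; elim: n f {sf} => [|n ih] f [df sf].
  by rewrite cderiv0.
by have := ih _ sf; rewrite !cderiv_comp addn1.
Qed.

Lemma smooth_cis_derive f n x : smooth f ->
  cis_derive (cderiv n f) x (cderiv n.+1 f x).
Proof.
by move=> sf; have := smooth_derivable n x sf; rewrite cderiv_comp.
Qed.

Lemma smooth_cderiv n f : smooth f -> smooth (cderiv n f).
Proof.
move=> sf m x; have := smooth_cis_derive (m + n) x sf.
by rewrite -cderiv_comp => /cis_derive_derivable.
Qed.

Lemma smooth_derive f x : smooth f -> cis_derive f x (cderiv 1 f x).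
Proof. by move=> /(smooth_cis_derive 0 x); rewrite cderiv0. Qed.

Lemma cderiv1D f g : smooth f -> smooth g ->
  cderiv 1 (fun x => f x + g x) = fun x => cderiv 1 f x + cderiv 1 g x.
Proof.
move=> sf sg; apply/funext => x; apply: cderiv1_val.
by apply: cis_deriveD; exact: smooth_derive.
Qed.

Lemma cderiv1M f g : smooth f -> smooth g ->
  cderiv 1 (fun x => f x * g x) =
  fun x => cderiv 1 f x * g x + f x * cderiv 1 g x.
Proof.
move=> sf sg; apply/funext => x; apply: cderiv1_val.
by apply: cis_deriveM; exact: smooth_derive.
Qed.

Lemma smooth_cst z : smooth (fun _ : R => z).
Proof.
apply/smoothP => n; elim: n z => [//|n ih] z; split=> [x|].
  by rewrite (cderiv1_val (cis_derive_cst z x)); exact: cis_derive_cst.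
rewrite (_ : cderiv 1 _ = fun=> 0); first exact: ih.
by apply/funext => x; exact: cderiv1_val (cis_derive_cst z x).
Qed.

Lemma nsmoothD n f g : nsmooth n f -> nsmooth n g ->
  nsmooth n (fun x => f x + g x).
Proof.
elim: n f g => [//|n ih] f g [df sf] [dg sg].
have dfg x := cis_deriveD (df x) (dg x).
(* Unfolding by conversion exposes both occurrences of the derivative, so that one rewrite replaces
   them. *)
have -> : nsmooth n.+1 (fun x => f x + g x) =
  ((forall x, cis_derive (fun x => f x + g x) x (cderiv 1 (fun x => f x + g x) x)) /\
  nsmooth n (cderiv 1 (fun x => f x + g x))) by [].
rewrite (_ : cderiv 1 _ = fun x => cderiv 1 f x + cderiv 1 g x); last first.
  by apply/funext => x; exact: cderiv1_val.
by split=> //; exact: ih.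
Qed.

Lemma nsmoothM n f g : nsmooth n f -> nsmooth n g ->
  nsmooth n (fun x => f x * g x).
Proof.
elim: n f g => [//|n ih] f g sf' sg'.
have [df sf] := sf'; have [dg sg] := sg'.
have dfg x := cis_deriveM (df x) (dg x).
have -> : nsmooth n.+1 (fun x => f x * g x) =
  ((forall x, cis_derive (fun x => f x * g x) x (cderiv 1 (fun x => f x * g x) x)) /\
  nsmooth n (cderiv 1 (fun x => f x * g x))) by [].
rewrite (_ : cderiv 1 _ = fun x => cderiv 1 f x * g x + f x * cderiv 1 g x);
  last by apply/funext => x; exact: cderiv1_val.
(* Each term of the product rule keeps one undifferentiated factor, whose smoothness is lowered from
   order [n.+1] to [n]. *)
split=> //; apply: nsmoothD; first exact: (ih _ _ sf (nsmoothW sg')).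
exact: (ih _ _ (nsmoothW sf') sg).
Qed.

Lemma smoothD f g : smooth f -> smooth g -> smooth (fun x => f x + g x).
Proof. by move=> /smoothP sf /smoothP sg; apply/smoothP => n; exact: nsmoothD. Qed.

Lemma smoothM f g : smooth f -> smooth g -> smooth (fun x => f x * g x).
Proof. by move=> /smoothP sf /smoothP sg; apply/smoothP => n; exact: nsmoothM. Qed.

Lemma smoothZ z f : smooth f -> smooth (fun x => z * f x).
Proof. by move=> sf; exact: (smoothM (smooth_cst z) sf). Qed.

Lemma cderivS n f : cderiv n.+1 f = cderiv n (cderiv 1 f).
Proof. by rewrite cderiv_comp addn1. Qed.

Lemma cderivD n f g : smooth f -> smooth g ->
  cderiv n (fun x => f x + g x) = fun x => cderiv n f x + cderiv n g x.
Proof.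
elim: n f g => [|n ih] f g sf sg; first by rewrite !cderiv0.
rewrite !(cderivS n) (cderiv1D sf sg).
exact: (ih _ _ (smooth_cderiv 1 sf) (smooth_cderiv 1 sg)).
Qed.

Lemma cderivZ n z f : smooth f ->
  cderiv n (fun x => z * f x) = fun x => z * cderiv n f x.
Proof.
elim: n f => [|n ih] f sf; first by rewrite !cderiv0.
rewrite !(cderivS n) (_ : cderiv 1 _ = fun x => z * cderiv 1 f x).
  exact: (ih _ (smooth_cderiv 1 sf)).
rewrite (cderiv1M (smooth_cst z) sf); apply/funext => x.
by rewrite (cderiv1_val (cis_derive_cst z x)) mul0r add0r.
Qed.

(** The difference quotients themselves coincide, so the identity holds for every [p],
    differentiable or not. *)
Lemma derive1_shift (p : R -> R) (h : R) :
  derive1 (fun x => p (x + h)) = fun x => derive1 p (x + h).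
Proof.
apply/funext => x; rewrite /derive1.
rewrite (_ : (fun t => _) = fun t : R => t^-1 *: (p (t + (x + h)) - p (x + h)))//.
by apply/funext => t; rewrite addrA.
Qed.

Lemma derive1n_shift n (p : R -> R) (h : R) :
  derive1n n (fun x => p (x + h)) = fun x => derive1n n p (x + h).
Proof. by elim: n => // n ih; rewrite !derive1nS ih derive1_shift. Qed.

Lemma cderiv_shift n f (h : R) :
  cderiv n (fun x => f (x + h)) = fun x => cderiv n f (x + h).
Proof.
apply/funext => x; rewrite /cderiv.
rewrite (_ : rpart _ = fun x => rpart f (x + h))//.
rewrite (_ : ipart _ = fun x => ipart f (x + h))//.
by rewrite !derive1n_shift.
Qed.

Lemma smooth_shift f (h : R) : smooth f -> smooth (fun x => f (x + h)).
Proof.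
have dshift (p : R -> R) x : derivable p (x + h) 1 ->
    derivable (fun y => p (y + h)) x 1.
  rewrite /derivable.
  have -> // : (fun t => t^-1 *: ((p \o shift (x + h)) (t *: 1) - p (x + h))) =
      fun t => t^-1 *: (((fun y => p (y + h)) \o shift x) (t *: 1) - p (x + h)).
  by apply/funext => t /=; rewrite addrA.
move=> sf n x; have [fr fi] := sf n (x + h).
have -> : rpart (fun y => f (y + h)) = fun y => rpart f (y + h) by [].
have -> : ipart (fun y => f (y + h)) = fun y => ipart f (y + h) by [].
by rewrite !derive1n_shift; split; [exact: dshift fr|exact: dshift fi].
Qed.

Lemma smooth_continuous f : smooth f -> continuous f.
Proof.
move=> sf x; have [fr fi] := cis_derive_derivable (smooth_derive x sf).
apply/cvg_Cplx; split.
  by have /derivable1_diffP/differentiable_continuous := fr.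
by have /derivable1_diffP/differentiable_continuous := fi.
Qed.

(** The set [a < |x|] is open, so near each of its points the function is constantly 0. *)
Lemma derive1n_eq0_outside n (p : R -> R) (a : R) :
  (forall x, a < `|x| -> p x = 0) -> forall x, a < `|x| -> derive1n n p x = 0.
Proof.
move=> p0; elim: n => // n ih x ax; rewrite derive1nS derive1E.
rewrite (@near_eq_derive _ _ _ _ (cst 0)) ?derive_cst//.
have : \forall y \near x, a < `|y|.
  exact: (cvgr_gt _ (@norm_continuous _ R^o x) _ ax).
by apply: filterS => y; exact: ih.
Qed.

End complex_derivative.

(** * Test functions, norm comparison and continuity of functionals *)

Section test_functions.
Variable R : realType.
Local Notation mu := (@lebesgue_measure R).
Implicit Types (f g phi psi : R -> Cplx R) (a h : R).

Lemma test_on_cderiv a n phi : test_on a phi -> test_on a (cderiv n phi).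
Proof.
move=> [sphi phi0]; split; first exact: (smooth_cderiv n sphi).
move=> x ax; apply: Cplx_eq; rewrite /cderiv.
  by apply: (derive1n_eq0_outside n _ ax) => y ay; rewrite /rpart (phi0 _ ay).
by apply: (derive1n_eq0_outside n _ ax) => y ay; rewrite /ipart (phi0 _ ay).
Qed.

Lemma test_cderiv n phi : test phi -> test (cderiv n phi).
Proof. by move=> [a ta]; exists a; exact: (test_on_cderiv n ta). Qed.

Lemma test_on_lin a (c : Cplx R) phi psi : test_on a phi -> test_on a psi ->
  test_on a (fun x => c * phi x + psi x).
Proof.
move=> [sphi phi0] [spsi psi0]; split.
  exact: (smoothD (smoothZ c sphi) spsi).
by move=> x ax; rewrite (phi0 _ ax) (psi0 _ ax) mulr0 addr0.
Qed.

Lemma test_onW a b phi : a <= b -> test_on a phi -> test_on b phi.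
Proof.
by move=> ab [sphi phi0]; split=> // x bx; apply: phi0; exact: le_lt_trans bx.
Qed.

Lemma test_lin (c : Cplx R) phi psi : test phi -> test psi ->
  test (fun x => c * phi x + psi x).
Proof.
move=> [a ta] [b tb]; exists (Num.max a b); apply: test_on_lin.
  by apply: test_onW ta; rewrite le_max lexx.
by apply: test_onW tb; rewrite le_max lexx orbT.
Qed.

Lemma testM f phi : smooth f -> test phi -> test (fun x => f x * phi x).
Proof.
move=> sf [a [sphi phi0]]; exists a; split; first exact: (smoothM sf sphi).
by move=> x ax; rewrite (phi0 _ ax) mulr0.
Qed.

Lemma test_shift h phi : test phi -> test (fun x => phi (x + h)).
Proof.
move=> [a [sphi phi0]]; exists (a + `|h|); split; first exact: (smooth_shift h sphi).
move=> x ax; apply: phi0; have := ler_normD (x + h) (- h).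
by rewrite addrK normrN -lerBlDr; apply: lt_le_trans; rewrite ltrBrDr.
Qed.

Lemma test_on_bounded a phi : test_on a phi ->
  exists C : R, forall x, modulus (phi x) <= C.
Proof.
move=> [sphi phi0]; have cphi := smooth_continuous sphi.
(* A continuous real majorant of the modulus, to which the extreme value theorem applies. *)
pose p x := `|rpart phi x| + `|ipart phi x|.
have cp : continuous p.
  move=> x; have /cvg_Cplx[cr ci] := cphi x.
  by apply: cvgD; apply: cvg_norm; [exact: cr|exact: ci].
(* The radius [a] may be negative, hence the interval with endpoints [-|a|] and [|a|]. *)
have aa : - `|a| <= `|a| by rewrite -subr_ge0 opprK addr_ge0.
have [c _ cmax] := EVT_max aa (continuous_subspaceT cp).
exists (p c) => x; have [xa|xa] := leP `|x| `|a|.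
  apply: (le_trans (modulus_le (phi x))); apply: cmax.
  by rewrite in_itv/= -ler_norml.
by rewrite phi0 ?(le_lt_trans (ler_norm a))// modulus0 addr_ge0.
Qed.

Lemma test_cintegrable phi : test phi -> cintegrable phi.
Proof.
move=> [a ta]; have [C phiC] := test_on_bounded ta.
have [sphi phi0] := ta.
apply: (@cintegrable_le _ _ (fun x => C * \1_(`[- `|a|, `|a|]%classic) x)).
- exact/continuous_cmeasurable/smooth_continuous.
- exact: (integrableZl measurableT C (integrable_indic_itv (- `|a|) `|a| true false)).
move=> x; have [xa|xa] := leP `|x| `|a|.
  rewrite indicE mem_set ?mulr1//=.
  by rewrite in_itv/= -ler_norml.
rewrite phi0 ?(le_lt_trans (ler_norm a))// modulus0 mulr_ge0//.
by rewrite (le_trans _ (phiC 0))// modulus_ge0.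
Qed.

Lemma test_DLp1 phi : test phi -> DLp 1%E phi.
Proof.
move=> tphi; split; first by have [a []] := tphi.
by move=> i; apply/Lp1_cintegrable; apply: test_cintegrable; exact: test_cderiv.
Qed.

(** The integral reduces to an interval of length [2 * |a|], on which the essential supremum bounds
    the integrand almost everywhere. Bounds in L^1 norms thus give continuity on each
    [test_on a]. *)
Lemma Lpnorm1_le_Lpnormoo a phi : test_on a phi ->
  (Lpnorm 1 phi <= (2 * `|a|)%:E * Lpnorm +oo phi)%E.
Proof.
move=> ta; have [sphi phi0] := ta.
have mphi : measurable_fun setT (fun x : R => modulus (phi x)).
  exact/measurable_modulus/continuous_cmeasurable/smooth_continuous.
have mabs : measurable_fun setT (fun x : R => `|(modulus (phi x))%:E|)%E.
  by apply: measurableT_comp => //; exact/measurable_EFinP.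
set L := Lpnorm +oo phi; have L0 : (0 <= L)%E by exact: Lnorm_ge0.
have aeL : \forall x \ae mu, (`|(modulus (phi x))%:E| <= L)%E.
  (* At exponent [+oo] the norm unfolds to an essential supremum only once the whole space is known
     to have positive measure. *)
  have muT : (0 < mu setT)%E.
    by rewrite -set_itvNyy lebesgue_measure_itv/= addye.
  by rewrite /L /Lpnorm Lnorm.unlock muT; exact: ess_sup_ge.
rewrite /Lpnorm Lnorm1.
pose D : set R := `[- `|a|, `|a|]%classic.
have -> : (\int[mu]_x `|(modulus (phi x))%:E| =
           \int[mu]_(x in D) `|(modulus (phi x))%:E|)%E.
  rewrite [RHS]integral_mkcond; apply: eq_integral => x _.
  rewrite patchE; case: ifPn => // /negP xD.
  have -> : phi x = 0.
    apply: phi0; rewrite (le_lt_trans (ler_norm a))// ltNge.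
    by apply/negP => xa; apply: xD; rewrite inE /D/= in_itv/= -ler_norml.
  by rewrite modulus0 abse0.
apply: (@le_trans _ _ (\int[mu]_(x in D) L)%E).
  apply: ae_ge0_le_integral => //.
  - exact: measurable_itv.
  - exact: measurable_funTS mabs.
  - by apply: (@filterS _ _ (ae_filter_ringOfSetsType _) _ _ _ aeL) => x.
rewrite integral_cst; last exact: measurable_itv.
have muD : (mu D <= (2 * `|a|)%:E)%E.
  rewrite /D lebesgue_measure_itv/= lte_fin; case: ifPn => _.
    by rewrite -EFinB opprK mulr_natl mulr2n.
  by rewrite lee_fin mulr_ge0.
by rewrite muleC; apply: lee_wpmul2r.
Qed.

Lemma snorm1_le_snormoo a m phi : test_on a phi ->
  (snorm m 1 phi <= (2 * `|a|)%:E * snorm m +oo phi)%E.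
Proof.
move=> ta; rewrite /snorm ge0_sume_distrr; last first.
  by move=> i _; exact: Lnorm_ge0.
apply: lee_sum => i _; apply: Lpnorm1_le_Lpnormoo.
exact: (test_on_cderiv i ta).
Qed.

Lemma DLp1_lin (c : Cplx R) phi psi : DLp 1%E phi -> DLp 1%E psi ->
  DLp 1%E (fun x => c * phi x + psi x).
Proof.
move=> [sphi iphi] [spsi ipsi]; split.
  exact: (smoothD (smoothZ c sphi) spsi).
move=> i; rewrite (cderivD i (smoothZ c sphi) spsi) (cderivZ i c sphi).
apply/Lp1_cintegrable; apply: cintegrableD.
  by apply: cintegrableZ; apply/Lp1_cintegrable; exact: iphi.
by apply/Lp1_cintegrable; exact: ipsi.
Qed.

(** By linearity, the increment of [U] is its value at the difference, which a single norm
    controls. *)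
Lemma continuous_on_bounded (E : set (R -> Cplx R)) (p : \bar R)
    (U : functional R) (m : nat) (C : R) :
  (forall (c : Cplx R) phi psi, E phi -> E psi -> E (fun x => c * phi x + psi x)) ->
  linear_on E U -> 0 <= C ->
  (forall phi, E phi -> ((modulus (U phi))%:E <= C%:E * snorm m p phi)%E) ->
  continuous_on E p U.
Proof.
move=> Elin Ulin C0 UC phi0 Ephi0 e e0.
(* The added 1 keeps the denominator positive when [C] is 0 and makes the final inequality
   strict. *)
exists m, (e / (C + 1)); have C10 : 0 < C + 1 by rewrite ltr_wpDl.
split=> [|phi Ephi]; first exact: divr_gt0.
(* The difference is put in the shape [c * phi + psi] under which [E] is stable and [U] linear. *)
have -> : (fun x => phi x - phi0 x) = (fun x => -1 * phi0 x + phi x).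
  by apply/funext => x; rewrite mulN1r addrC.
move=> h; have := UC _ (Elin (-1) _ _ Ephi0 Ephi).
rewrite Ulin// mulN1r addrC -lte_fin => /le_lt_trans; apply.
have s0 : (0 <= snorm m p (fun x => (-1 * phi0 x + phi x)%R))%E.
  by apply: sume_ge0 => i _; exact: Lnorm_ge0.
apply: (@le_lt_trans _ _ (C%:E * (e / (C + 1))%:E)%E).
  by rewrite lee_wpmul2l ?lee_fin// ltW.
rewrite -EFinM lte_fin mulrCA -ltr_pdivlMl// mulVf ?gt_eqF//.
by rewrite ltr_pdivrMr// mul1r ltrDl.
Qed.

Lemma regular_lin f (c : Cplx R) phi psi : cmeasurable f ->
  (exists C, forall x, modulus (f x) <= C) ->
  cintegrable phi -> cintegrable psi ->
  regular f (fun x => c * phi x + psi x) = c * regular f phi + regular f psi.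
Proof.
move=> mf [C fC] iphi ipsi; rewrite /regular.
have i1 := cintegrableM iphi mf fC; have i2 := cintegrableM ipsi mf fC.
rewrite -(cintegralZ c i1) -cintegralD//; last exact: cintegrableZ.
by congr cintegral; apply/funext => x; rewrite mulrDr mulrCA.
Qed.

Lemma le_modulus_regular f phi (C : R) : cmeasurable f ->
  (forall x, modulus (f x) <= C) -> cintegrable phi ->
  ((modulus (regular f phi))%:E <= (2 * C)%:E * Lpnorm 1 phi)%E.
Proof.
move=> mf fC iphi; have C0 : 0 <= C by apply: le_trans (fC 0); exact: modulus_ge0.
apply: (le_trans (le_modulus_cintegral (cintegrableM iphi mf fC))).
rewrite EFinM -muleA lee_wpmul2l// /Lpnorm !Lnorm1.
have mphi : measurable_fun setT (EFin \o (fun x : R => modulus (phi x))).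
  exact/measurable_EFinP/measurable_modulus/cintegrable_cmeasurable.
rewrite -ge0_integralZl//; last first.
  exact: measurableT_comp.
apply: ge0_le_integral => //.
- apply: measurableT_comp => //; apply/measurable_EFinP/measurable_modulus.
  by apply: cmeasurableM => //; exact: cintegrable_cmeasurable.
- by apply: measurable_funeM; exact: measurableT_comp.
move=> x _; rewrite /= -EFinM lee_fin modulusM normrM.
by rewrite ler_wpM2r// ger0_norm ?modulus_ge0.
Qed.

End test_functions.

(** * Finite sums of derivatives of almost automorphic functions *)

Section representations.
Variable R : realType.
Local Notation mu := (@lebesgue_measure R).
Implicit Types (f g phi psi : R -> Cplx R) (T U : functional R).

Lemma modulus_sum (I : Type) (r : seq I) (F : I -> Cplx R) :
  modulus (\sum_(i <- r) F i) <= \sum_(i <- r) modulus (F i).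
Proof.
elim: r => [|i r ih]; first by rewrite !big_nil modulus0.
by rewrite !big_cons (le_trans (modulusD _ _))// lerD2l.
Qed.

Lemma regularDl f g phi : cintegrable (fun x => f x * phi x) ->
  cintegrable (fun x => g x * phi x) ->
  regular (fun x => f x + g x) phi = regular f phi + regular g phi.
Proof.
move=> fi gi; rewrite /regular -(cintegralD fi gi); congr cintegral.
by apply/funext => x; rewrite mulrDl.
Qed.

Lemma regularZl (c : Cplx R) f phi : cintegrable (fun x => f x * phi x) ->
  regular (fun x => c * f x) phi = c * regular f phi.
Proof.
move=> fi; rewrite /regular -(cintegralZ c fi); congr cintegral.
by apply/funext => x; rewrite mulrA.
Qed.

Lemma regular0 phi : regular (fun=> 0) phi = 0.
Proof.
rewrite /regular -[RHS]cintegral0; congr cintegral.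
by apply/funext => x; rewrite mul0r.
Qed.

Lemma aa_cintegrableM f phi : almost_automorphic f -> cintegrable phi ->
  cintegrable (fun x => f x * phi x).
Proof.
move=> faa iphi; have [C fC] := aa_bounded faa.
exact: (cintegrableM iphi (aa_cmeasurable faa) fC).
Qed.

Lemma test_cderiv_cintegrable j phi : test phi -> cintegrable (cderiv j phi).
Proof. by move=> tphi; apply: test_cintegrable; exact: test_cderiv. Qed.

Lemma dderiv_comp m n T phi :
  dderiv m (dderiv n T) phi = dderiv (n + m) T phi.
Proof. by rewrite /dderiv cderiv_comp mulrA -exprD addnC. Qed.

(** Padding with zero functions brings two representations of different lengths to a common one, so
    that they can be added termwise. *)
Lemma sum_dderiv_widen k K (f : nat -> R -> Cplx R) phi : (k <= K)%N ->
  sum_dderiv k f phi =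
  sum_dderiv K (fun j => if (j <= k)%N then f j else fun=> 0) phi.
Proof.
move=> kK; rewrite /sum_dderiv.
rewrite (big_ord_widen K.+1 (fun j => dderiv j (regular (f j)) phi)) ?ltnS//.
rewrite big_mkcond/=; apply: eq_bigr => j _; rewrite ltnS.
by case: ifPn => // _; rewrite /dderiv regular0 mulr0.
Qed.

(** The representation clause of [aa_distribution] alone; [aa_formP] recovers boundedness from
    it. *)
Definition aa_form T : Prop :=
  exists (k : nat) (f : nat -> R -> Cplx R),
    (forall j, (j <= k)%N -> almost_automorphic (f j)) /\
    eq_on_test T (sum_dderiv k f).

Lemma aa_form_ext T U : eq_on_test T U -> aa_form U -> aa_form T.
Proof.
by move=> TU [k [f [faa fU]]]; exists k, f; split=> // phi tphi; rewrite TU// fU.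
Qed.

Lemma aa_form_dderiv_regular n f : almost_automorphic f ->
  aa_form (dderiv n (regular f)).
Proof.
move=> faa; exists n, (fun j => if (j == n)%N then f else fun=> 0); split.
  by move=> j _ /=; case: (j == n)%N; [exact: faa|exact: aa_cst].
move=> phi _; rewrite /sum_dderiv big_ord_recr/= eqxx big1 ?add0r// => j _.
by rewrite ltn_eqF// /dderiv regular0 mulr0.
Qed.

Lemma aa_form0 : aa_form (fun=> 0).
Proof.
exists 0%N, (fun _ _ => 0); split; first by move=> j _; exact: aa_cst.
by move=> phi _; rewrite /sum_dderiv big_ord1 /dderiv regular0 mulr0.
Qed.

Lemma aa_formD T U : aa_form T -> aa_form U -> aa_form (fun phi => T phi + U phi).
Proof.
move=> [k [f [faa fT]]] [l [g [gaa gU]]].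
pose f' j := if (j <= k)%N then f j else fun=> 0.
pose g' j := if (j <= l)%N then g j else fun=> 0.
have f'aa j : almost_automorphic (f' j).
  by rewrite /f'; case: ifPn => [/faa//|_]; exact: aa_cst.
have g'aa j : almost_automorphic (g' j).
  by rewrite /g'; case: ifPn => [/gaa//|_]; exact: aa_cst.
exists (maxn k l), (fun j x => f' j x + g' j x); split.
  by move=> j _; exact: (aaD (f'aa j) (g'aa j)).
move=> phi tphi; rewrite fT// gU// (sum_dderiv_widen _ _ (leq_maxl k l)).
rewrite (sum_dderiv_widen g _ (leq_maxr k l)) /sum_dderiv -big_split/=.
apply: eq_bigr => j _; rewrite /dderiv -mulrDr regularDl//.
  by apply: aa_cintegrableM => //; exact: test_cderiv_cintegrable.
by apply: aa_cintegrableM => //; exact: test_cderiv_cintegrable.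
Qed.

Lemma aa_formZ (c : Cplx R) T : aa_form T -> aa_form (fun phi => c * T phi).
Proof.
move=> [k [f [faa fT]]]; exists k, (fun j x => c * f j x); split.
  by move=> j jk; exact: (aaZ c (faa j jk)).
move=> phi tphi; rewrite fT// /sum_dderiv mulr_sumr; apply: eq_bigr => j _.
rewrite /dderiv mulrCA regularZl//; apply: aa_cintegrableM.
  by apply: faa; rewrite -ltnS.
exact: test_cderiv_cintegrable.
Qed.

Lemma aa_form_sum (I : Type) (r : seq I) (P : pred I) (T : I -> functional R) :
  (forall i, P i -> aa_form (T i)) ->
  aa_form (fun phi => \sum_(i <- r | P i) T i phi).
Proof.
move=> Taa; elim: r => [|i r ih].
  by apply: (aa_form_ext _ aa_form0) => phi _; rewrite big_nil.
have [Pi|/negbTE nPi] := boolP (P i).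
  apply: (aa_form_ext _ (aa_formD (Taa i Pi) ih)) => phi _.
  by rewrite big_cons Pi.
by apply: (aa_form_ext _ ih) => phi _; rewrite big_cons nPi.
Qed.

Lemma aa_form_dderiv i T : aa_form T -> aa_form (dderiv i T).
Proof.
move=> [k [f [faa fT]]].
apply: (@aa_form_ext _ (fun phi => \sum_(j < k.+1) dderiv (j + i) (regular (f j)) phi)).
  move=> phi tphi; rewrite {1}/dderiv fT; last exact: test_cderiv.
  rewrite /sum_dderiv mulr_sumr; apply: eq_bigr => j _.
  by rewrite -dderiv_comp.
apply: aa_form_sum => j _; apply: aa_form_dderiv_regular; apply: faa.
by rewrite -ltnS.
Qed.

Lemma sum_dderiv_lin k (f : nat -> R -> Cplx R) :
  (forall j, (j <= k)%N -> almost_automorphic (f j)) ->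
  linear_on (DLp 1%E) (sum_dderiv k f).
Proof.
move=> faa c phi psi [sphi iphi] [spsi ipsi].
rewrite /sum_dderiv mulr_sumr -big_split/=; apply: eq_bigr => j _.
have jaa : almost_automorphic (f j) by apply: faa; rewrite -ltnS.
rewrite /dderiv (cderivD j (smoothZ c sphi) spsi) (cderivZ j c sphi).
rewrite (regular_lin c (aa_cmeasurable jaa) (aa_bounded jaa)
  ((Lp1_cintegrable _).1 (iphi j)) ((Lp1_cintegrable _).1 (ipsi j))).
by rewrite mulrDr mulrCA.
Qed.

Lemma sum_dderiv_bounded k (f : nat -> R -> Cplx R) :
  (forall j, (j <= k)%N -> almost_automorphic (f j)) ->
  exists2 C : R, 0 <= C & forall phi, DLp 1%E phi ->
    ((modulus (sum_dderiv k f phi))%:E <= C%:E * snorm k 1 phi)%E.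
Proof.
move=> faa.
(* One bound per index, with 0 as a default beyond [k], where nothing is claimed. *)
have /choice[c cP] (j : nat) : exists C : R, (j <= k)%N -> forall x, modulus (f j x) <= C.
  have [jk|//] := boolP (j <= k)%N; last by exists 0.
  by have [C fC] := aa_bounded (faa j jk); exists C.
pose C := \sum_(j < k.+1) `|c j|.
have C0 : 0 <= C by exact: sumr_ge0.
exists (2 * C) => [|phi [sphi iphi]]; first by rewrite mulr_ge0.
apply: (@le_trans _ _ (\sum_(j < k.+1) (modulus (dderiv j (regular (f j)) phi))%:E)%E).
  by rewrite sumEFin lee_fin; exact: modulus_sum.
rewrite /snorm ge0_sume_distrr; last by move=> i _; exact: Lnorm_ge0.
apply: lee_sum => j _; rewrite /dderiv modulusM modulusXN1 mul1r.
have jk : (j <= k)%N by rewrite -ltnS.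
apply: le_modulus_regular; first exact: aa_cmeasurable (faa j jk).
  move=> x; rewrite (le_trans (cP j jk x))// (le_trans (ler_norm _))//.
  by rewrite /C (bigD1 j)//= lerDl sumr_ge0.
exact/Lp1_cintegrable/iphi.
Qed.

(** The representing sum is itself the extension of [T] to the space of [DLp 1]: it is linear there
    and bounded by the norm of order [k]. *)
Lemma aa_formP T : aa_form T -> aa_distribution T.
Proof.
move=> [k [f [faa fT]]]; split; last by exists k, f.
have Ulin := sum_dderiv_lin faa.
have [C C0 UC] := sum_dderiv_bounded faa.
split; last first.
  exists (sum_dderiv k f) => //; split=> //.
  by apply: (continuous_on_bounded _ Ulin C0 UC) => c phi psi; exact: DLp1_lin.
have Tlin : linear_on (@test R) T.
  move=> c phi psi tphi tpsi; rewrite !fT//; last exact: test_lin.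
  by rewrite Ulin//; exact: test_DLp1.
split=> // a.
(* The constant combines the L^1 bound [C] with the factor [2 * |a|] of the comparison of norms. *)
apply: (@continuous_on_bounded _ _ _ _ k (C * (2 * `|a|))).
- by move=> c phi psi; exact: test_on_lin.
- by move=> c phi psi tphi tpsi; apply: Tlin; exists a.
- by rewrite mulr_ge0// mulr_ge0.
move=> phi tphi; have tphi' : test phi by exists a.
rewrite fT//; apply: (le_trans (UC _ (test_DLp1 tphi'))).
rewrite EFinM -muleA lee_wpmul2l ?lee_fin//.
exact: snorm1_le_snormoo.
Qed.

End representations.

(** * Convolution with integrable functions by Fubini *)

Section convolution.
Variable R : realType.
Local Notation mu := (@lebesgue_measure R).
Implicit Types (f g phi psi : R -> Cplx R) (T U : functional R).

(** The identity that pairing [f * g] with [psi] amounts to integrating [g y] times the pairing of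
    [f] with [psi (. + y)], bundled with integrability. It is made a predicate because it is
    established both for L^oo and for almost automorphic [f]. *)
Definition regular_fconv f : Prop := forall g psi, cintegrable g -> test psi ->
  cintegrable (fun y => g y * regular f (fun x => psi (x + y))) /\
  regular (fconv f g) psi =
  cintegral (fun y => g y * regular f (fun x => psi (x + y))).

(** The kernel [f (x - y) * g y * psi x] is dominated by [modulus (psi x)] times
    [C * modulus (g y)], so Fubini applies. *)
Lemma bounded_regular_fconv f : cmeasurable f ->
  (exists C, forall x, modulus (f x) <= C) -> regular_fconv f.
Proof.
move=> mf [C fC] g psi ig tpsi.
have ipsi := test_cintegrable tpsi.
have mg := cintegrable_cmeasurable ig; have mpsi := cintegrable_cmeasurable ipsi.
have C0 : 0 <= C by apply: le_trans (fC 0); exact: modulus_ge0.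
pose K (z : R * R) := f (z.1 - z.2) * g z.2 * psi z.1.
have mK : cmeasurable K.
  apply: cmeasurableM; first apply: cmeasurableM.
  - apply: (cmeasurable_comp mf); apply: measurable_funB.
      exact: measurable_fst.
    exact: measurable_snd.
  - by apply: (cmeasurable_comp mg); exact: measurable_snd.
  - by apply: (cmeasurable_comp mpsi); exact: measurable_fst.
have [x y|iK eK] := cintegral_fubini mK (cintegrable_modulus ipsi)
    (integrableZl measurableT C (cintegrable_modulus ig)).
  rewrite /K /= !modulusM mulrC ler_wpM2l ?modulus_ge0//.
  by rewrite ler_wpM2r ?modulus_ge0.
(* For fixed [y], substituting [x - y] for [x] moves the translation from [f] to [psi]. *)
have innerE y : cintegral (fun x => K (x, y)) =
    g y * regular f (fun x => psi (x + y)).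
  have ipsiy : cintegrable (fun x => psi (x + y)).
    exact: (measure_preserving_cintegrable (measure_preserving_addr y) ipsi).
  have ify := cintegrableM ipsiy mf fC.
  rewrite /regular -(cintegralZ _ ify).
  rewrite -(measure_preserving_cintegral (measure_preserving_addr (- y))
    (f := fun x => g y * (f x * psi (x + y)))).
    by congr cintegral; apply/funext => x; rewrite subrK /K /= mulrCA mulrA.
  exact: cintegrable_cmeasurable (cintegrableZ _ ify).
split; first by rewrite -(funext innerE).
rewrite -(funext innerE) -eK /regular; congr cintegral; apply/funext => x.
have ifx : cintegrable (fun y => f (x - y) * g y).
  apply: (cintegrableM ig _ (fun y => fC (x - y))).
  exact: (measure_preserving_cmeasurable (measure_preserving_subl x) mf).
rewrite /fconv mulrC -(cintegralZ _ ifx); congr cintegral.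
by apply/funext => y; rewrite /K /= mulrC.
Qed.

Lemma ae_eq_cintegral f g : cmeasurable f -> cmeasurable g ->
  (\forall x \ae mu, f x = g x) -> cintegral f = cintegral g.
Proof.
move=> [fr fi] [gr gi] fg; rewrite /cintegral.
congr (_ +i* _)%C; congr fine; apply: ae_eq_integral => //.
- exact/measurable_EFinP.
- exact/measurable_EFinP.
- by apply: (@filterS _ _ (ae_filter_ringOfSetsType _) _ _ _ fg) => x fgx _;
  rewrite /rpart fgx.
- exact/measurable_EFinP.
- exact/measurable_EFinP.
- by apply: (@filterS _ _ (ae_filter_ringOfSetsType _) _ _ _ fg) => x fgx _;
  rewrite /ipart fgx.
Qed.

(** With the translation on [g], a change of [f] on a null set affects the integrand only on that
    same set. *)
Lemma fconvC f g x : cmeasurable f -> cmeasurable g ->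
  fconv f g x = cintegral (fun y => f y * g (x - y)).
Proof.
move=> mf mg; rewrite /fconv.
rewrite -(measure_preserving_cintegral (measure_preserving_subl x)
  (f := fun y => f y * g (x - y))).
  by congr cintegral; apply/funext => y; rewrite subKr.
apply: cmeasurableM => //.
exact: (measure_preserving_cmeasurable (measure_preserving_subl x) mg).
Qed.

(* The fconv of an L^oo function is defined through Lebesgue integrals over
   its values, which are bounded only almost everywhere; truncating it changes
   no integral and gives the pointwise bound that Fubini needs. *)
Lemma Lpoo_bounded_version f : Lp +oo%E f ->
  exists f', [/\ cmeasurable f', (exists C, forall x, modulus (f' x) <= C)
    & \forall x \ae mu, f x = f' x].
Proof.
move=> [fr fi]; have mf : cmeasurable f by [].
have muT : (0 < mu setT)%E by rewrite -set_itvNyy lebesgue_measure_itv/= addye.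
have L0 : (0 <= Lpnorm +oo f)%E by exact: Lnorm_ge0.
move=> Loo; have LE : Lpnorm +oo f = (fine (Lpnorm +oo f))%:E.
  by rewrite fineK// ge0_fin_numE.
set L := fine _ in LE.
have aeL : \forall x \ae mu, modulus (f x) <= L.
  have : \forall x \ae mu, (`|(modulus (f x))%:E| <= Lpnorm +oo f)%E.
    by rewrite /Lpnorm Lnorm.unlock muT; exact: ess_sup_ge.
  apply: (@filterS _ _ (ae_filter_ringOfSetsType _)) => x.
  by rewrite LE lee_fin; exact: le_trans (ler_norm _).
pose A := [set x | modulus (f x) <= L].
have mA : measurable (A : set R).
  rewrite (_ : A = setT `&` (fun x : R => modulus (f x)) @^-1` `]-oo, L]%classic).
    by apply: (measurable_modulus mf) => //.
  by rewrite setTI; apply/seteqP; split=> x /=; rewrite in_itv.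
exists (fun x => ((\1_A x : R)%:C)%C * f x); split.
- apply: cmeasurableM => //; split=> /=.
    exact: measurable_indic.
  exact: measurable_cst.
- exists L => x; rewrite modulusM indicE.
  have L0' : 0 <= L by rewrite fine_ge0.
  have [xA|xA] := boolP (x \in A).
    by rewrite (_ : modulus _ = 1) ?mul1r; [exact/set_mem|exact: Normc.normc1].
  by rewrite (_ : modulus _ = 0) ?mul0r//; exact: modulus0.
- apply: (@filterS _ _ (ae_filter_ringOfSetsType _) _ _ _ aeL) => x xA.
  rewrite indicE mem_set// (_ : (_%:C)%C = 1) ?mul1r//.
Qed.

(** Both sides see [f] only through integrals against measurable functions, so [f] can be replaced
    by its bounded version. *)
Lemma Lpoo_regular_fconv f : Lp +oo%E f -> regular_fconv f.
Proof.
move=> Lf; have [f' [mf' bf' ff']] := Lpoo_bounded_version Lf.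
have mf : cmeasurable f by have [] := Lf.
have regE psi : cmeasurable psi -> regular f psi = regular f' psi.
  move=> mpsi; apply: ae_eq_cintegral; [exact: cmeasurableM|exact: cmeasurableM|].
  by apply: (@filterS _ _ (ae_filter_ringOfSetsType _) _ _ _ ff') => x ->.
move=> g psi ig tpsi; have mg := cintegrable_cmeasurable ig.
have mpsi := cintegrable_cmeasurable (test_cintegrable tpsi).
have eI : (fun y => g y * regular f (fun x => psi (x + y))) =
    (fun y => g y * regular f' (fun x => psi (x + y))).
  by apply/funext => y; rewrite regE//; exact: cmeasurable_shift.
have eC : fconv f g = fconv f' g.
  apply/funext => x; rewrite !fconvC//; apply: regE.
  exact: (measure_preserving_cmeasurable (measure_preserving_subl x) mg).
rewrite eI eC; exact: (bounded_regular_fconv mf' bf').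
Qed.

Lemma aa_regular_fconv f : almost_automorphic f -> regular_fconv f.
Proof.
by move=> faa; apply: bounded_regular_fconv; [exact: aa_cmeasurable|exact: aa_bounded].
Qed.

(** After summation over [l], the right-hand side involves the functions [f l] only through the
    functional [sum_dderiv k f]; hence it is the same for all representations of one distribution.
    The sign [(-1) ^+ (l + j)] splits between the outer factor and [dderiv l]. *)
Lemma sum_dderiv_fconv k (f : nat -> R -> Cplx R) g j phi :
  (forall l, (l <= k)%N -> regular_fconv (f l)) -> cintegrable g -> test phi ->
  \sum_(l < k.+1) dderiv (l + j) (regular (fconv (f l) g)) phi =
  (-1) ^+ j * cintegral (fun y => g y *
    sum_dderiv k f (fun x => cderiv j phi (x + y))).
Proof.
move=> fk ig tphi.
have fP (l : 'I_k.+1) :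
    cintegrable (fun y => g y * regular (f l) (fun x => cderiv (l + j) phi (x + y))) /\
    regular (fconv (f l) g) (cderiv (l + j) phi) =
    cintegral (fun y => g y * regular (f l) (fun x => cderiv (l + j) phi (x + y))).
  by apply: fk => //; [rewrite -ltnS|exact: test_cderiv].
transitivity ((-1) ^+ j * cintegral (fun y => \sum_(l < k.+1)
    (-1) ^+ l * (g y * regular (f l) (fun x => cderiv (l + j) phi (x + y))))).
  rewrite cintegral_sum; last by move=> l; apply: cintegrableZ; have [] := fP l.
  rewrite mulr_sumr; apply: eq_bigr => l _; have [il el] := fP l.
  by rewrite cintegralZ// -el /dderiv mulrA -exprD addnC.
congr (_ * cintegral _); apply/funext => y; rewrite /sum_dderiv mulr_sumr.
apply: eq_bigr => l _; rewrite /dderiv (cderiv_shift l (cderiv j phi) y).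
by rewrite cderiv_comp mulrCA.
Qed.

End convolution.

(** * Convolution, multiplication, translation and vanishing at infinity for almost automorphic
    distributions *)

Section proposition6.
Variable R : realType.
Implicit Types (f g phi psi : R -> Cplx R) (T U S : functional R).

Lemma aa_form_conv T S U : aa_form T -> is_conv T S U -> aa_form U.
Proof.
move=> [k' [F [Faa TF]]] [k [m [f [g [fL gL Tf _ Ufg]]]]].
apply: (@aa_form_ext _ _ (fun phi => \sum_(j < m.+1) \sum_(l < k'.+1)
    dderiv (l + j) (regular (fconv (F l) (g j))) phi)); last first.
  apply: aa_form_sum => j _; apply: aa_form_sum => l _.
  apply: aa_form_dderiv_regular; apply: aa_fconv.
    by apply: Faa; rewrite -ltnS.
  by apply/Lp1_cintegrable/gL; rewrite -ltnS.
move=> phi tphi; rewrite Ufg// exchange_big/=; apply: eq_bigr => j _.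
have ig : cintegrable (g j) by apply/Lp1_cintegrable/gL; rewrite -ltnS.
rewrite sum_dderiv_fconv//; last by move=> l lk; exact/Lpoo_regular_fconv/fL.
rewrite sum_dderiv_fconv//; last by move=> l lk; exact/aa_regular_fconv/Faa.
congr (_ * cintegral _); apply/funext => y.
have ty : test (fun x => cderiv j phi (x + y)) by apply: test_shift; exact: test_cderiv.
(* Both representations evaluate to [T] on the translated test function. *)
by rewrite -Tf// TF.
Qed.

Lemma smooth_aa_cderiv n phi : smooth_aa phi -> smooth_aa (cderiv n phi).
Proof.
move=> [sphi phiaa]; split; first exact: (smooth_cderiv n sphi).
by move=> i; rewrite cderiv_comp; exact: phiaa.
Qed.

(** Induction on [j] for all [phi] at once, splitting the derivative of order [j + 1] of [phi * psi]
    into those of order [j] of [phi' * psi] and [phi * psi']. *)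
Lemma aa_form_leibniz j f phi : almost_automorphic f -> smooth_aa phi ->
  aa_form (fun psi => regular f (cderiv j (fun x => phi x * psi x))).
Proof.
move=> faa; elim: j phi => [|j ih] phi phiaa.
  apply: (@aa_form_ext _ _ (dderiv 0 (regular (fun x => f x * phi x)))).
    move=> psi _; rewrite /dderiv expr0 mul1r !cderiv0 /regular; congr cintegral.
    by apply/funext => x; rewrite mulrA.
  apply: aa_form_dderiv_regular.
  by have [_ /(_ 0%N)] := phiaa; rewrite cderiv0; exact: (aaM faa).
have [sphi _] := phiaa.
(* The term with [phi'] is the induction hypothesis for [phi']. The term with [psi'] is minus the
   distributional derivative of the functional given by the hypothesis for [phi], whence the
   coefficient -1. *)
apply: (aa_form_ext _ (aa_formD (ih _ (smooth_aa_cderiv 1 phiaa))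
  (aa_formZ (-1) (aa_form_dderiv 1 (ih _ phiaa))))) => psi tpsi.
have [a [spsi _]] := tpsi.
rewrite /dderiv expr1 mulrA mulrNN !mul1r cderivS (cderiv1M sphi spsi).
have t1 : test (fun x => cderiv 1 phi x * psi x).
  exact: testM (smooth_cderiv 1 sphi) tpsi.
have t2 : test (fun x => phi x * cderiv 1 psi x).
  exact: testM sphi (test_cderiv 1 tpsi).
have [a1 [s1 _]] := t1; have [a2 [s2 _]] := t2.
have -> : cderiv j (fun x => cderiv 1 phi x * psi x + phi x * cderiv 1 psi x) =
    fun x => 1 * cderiv j (fun x => cderiv 1 phi x * psi x) x +
             cderiv j (fun x => phi x * cderiv 1 psi x) x.
  by rewrite (cderivD j s1 s2); apply/funext => x; rewrite mul1r.
rewrite (regular_lin 1 (aa_cmeasurable faa) (aa_bounded faa)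
  (test_cderiv_cintegrable j t1) (test_cderiv_cintegrable j t2)).
by rewrite mul1r.
Qed.

Lemma aa_form_dmul phi T : smooth_aa phi -> aa_form T -> aa_form (dmul phi T).
Proof.
move=> phiaa [k [f [faa fT]]]; have [sphi _] := phiaa.
apply: (@aa_form_ext _ _ (fun psi => \sum_(j < k.+1)
   (-1) ^+ j * regular (f j) (cderiv j (fun x => phi x * psi x)))).
  by move=> psi tpsi; rewrite /dmul fT//; exact: testM.
apply: aa_form_sum => j _; apply: aa_formZ; apply: aa_form_leibniz => //.
by apply: faa; rewrite -ltnS.
Qed.

Lemma regular_shift f psi (h : R) : cmeasurable f -> cmeasurable psi ->
  regular f (fun x => psi (x - h)) = regular (fun x => f (x + h)) psi.
Proof.
move=> mf mpsi; rewrite /regular.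
rewrite -(measure_preserving_cintegral (measure_preserving_addr h)
  (f := fun x => f x * psi (x - h))).
  by congr cintegral; apply/funext => x; rewrite addrK.
by apply: cmeasurableM => //; exact: (cmeasurable_shift (- h)).
Qed.

Lemma aa_form_dtranslate h T : aa_form T -> aa_form (dtranslate h T).
Proof.
move=> [k [f [faa fT]]].
exists k, (fun j x => f j (x + h)); split.
  by move=> j jk; exact: (aa_shift h (faa j jk)).
move=> phi tphi; rewrite /dtranslate fT; last exact: test_shift.
apply: eq_bigr => j _; rewrite /dderiv (cderiv_shift j phi (- h)) regular_shift//.
  by apply: aa_cmeasurable; apply: faa; rewrite -ltnS.
exact: cintegrable_cmeasurable (test_cderiv_cintegrable j tphi).
Qed.

(** As a function of [h], the pairing of [f] with a translate of [psi] is a convolution with the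
    reflected [psi], to which [aa_fconv] applies. *)
Lemma regular_shift_fconv f psi (h : R) : cmeasurable f -> cmeasurable psi ->
  regular f (fun x => psi (x - h)) = fconv f (fun y => psi (0 - y)) h.
Proof.
move=> mf mpsi; rewrite fconvC//; last first.
  exact: (measure_preserving_cmeasurable (measure_preserving_subl 0) mpsi).
rewrite /regular; congr cintegral; apply/funext => x.
by rewrite sub0r opprB.
Qed.

Lemma aa_form_vanishing T : aa_form T -> vanishing_distribution T ->
  eq_on_test T (fun=> 0).
Proof.
move=> [k [f [faa fT]]] [_ Tvan] phi tphi.
have iphi j := test_cderiv_cintegrable j tphi.
pose u h := \sum_(j < k.+1) (-1) ^+ j *
  fconv (f j) (fun y => cderiv j phi (0 - y)) h.
have uE h : dtranslate h T phi = u h.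
  rewrite /dtranslate fT; last exact: test_shift.
  apply: eq_bigr => j _; rewrite /dderiv (cderiv_shift j phi (- h)).
  rewrite regular_shift_fconv//; last exact: cintegrable_cmeasurable (iphi j).
  by apply: aa_cmeasurable; apply: faa; rewrite -ltnS.
have uaa : almost_automorphic u.
  apply: aa_sum => j _; apply: aaZ; apply: aa_fconv.
    by apply: faa; rewrite -ltnS.
  exact: (measure_preserving_cintegrable (measure_preserving_subl 0) (iphi j)).
have u0 : u h @[h --> +oo] --> (0 : Cplx R).
  by rewrite -(funext uE); exact: Tvan.
(* The function [u] vanishes identically, and its value at 0 is [T phi]. *)
have := aa_cvg_pinfty0 uaa u0 0; rewrite -uE /dtranslate.
by rewrite (_ : (fun x => phi (x - 0)) = phi)//; apply/funext => x; rewrite subr0.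
Qed.

End proposition6.

Theorem proposition6 (R : realType) :
  (forall T : functional R, aa_distribution T ->
     forall i : nat, aa_distribution (dderiv i T)) /\
  (forall T : functional R, aa_distribution T -> vanishing_distribution T ->
     eq_on_test T (fun _ => 0%R)) /\
  (forall T : functional R, aa_distribution T ->
     forall h : R, aa_distribution (dtranslate h T)) /\
  (forall T S U : functional R, aa_distribution T ->
     integrable_distribution S -> is_conv T S U -> aa_distribution U) /\
  (forall (phi : R -> Cplx R) (T : functional R), smooth_aa phi ->
     aa_distribution T -> aa_distribution (dmul phi T)).
Proof.
split=> [T [_ aT] i|]; first exact/aa_formP/aa_form_dderiv.
split=> [T [_ aT]|]; first exact: aa_form_vanishing.
split=> [T [_ aT] h|]; first exact/aa_formP/aa_form_dtranslate.
split=> [T S U [_ aT] _ TSU|phi T phiaa [_ aT]].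
  exact/aa_formP/(aa_form_conv aT TSU).
exact/aa_formP/aa_form_dmul.
Qed.
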